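(* There is no finite-dimensional complex Lie algebra whose Jordan–Kronecker invariants contain exactly one Kronecker block, this block being of size $1\times1$, and more than one Jordan tuple with multiple maxima.
   Context: For a finite-dimensional complex Lie algebra $\mathfrak g$ and $x\in\mathfrak g^*$, let $\mathcal A_x$ be the skew form $(\xi,\eta)\mapsto\langle x,[\xi,\eta]\rangle$. By the Jordan–Kronecker theorem, a pair of skew forms on a finite-dimensional complex vector space admits a basis in which both are block-diagonal with Jordan $2n\times2n$ blocks with eigenvalues $\mu\in\mathbb C\cup\{\infty\}$ and Kronecker $(2k-1)\times(2k-1)$ blocks ($k\ge1$); block data grouped by eigenvalue are unique. The JK invariants of $\mathfrak g$ are the Kronecker sizes and Jordan tuples $J_{\lambda_i}(2n_{i1},\dots,2n_{is_i})$, $n_{i1}\ge\dots\ge n_{is_i}$ (sizes of Jordan blocks with common eigenvalue $\lambda_i$) of $(\mathcal A_x,\mathcal A_a)$ for $(x,a)$ in a nonempty Zariski open subset of $\mathfrak g^*\times\mathfrak g^*$ where they are constant. A Jordan tuple has multiple maxima if $s_i\ge2$ and $n_{i1}=n_{i2}$. *)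

(* Defs.v *)
From mathcomp Require Import all_boot all_algebra.
From mathcomp Require Import reals Rstruct complex.
From mathcomp Require mpoly.

Set Implicit Arguments.
Unset Strict Implicit.
Unset Printing Implicit Defensive.

Import GRing.Theory.
Local Open Scope ring_scope.

Definition C : closedFieldType := Rdefinitions.R[i].

(** * Finite-dimensional complex Lie algebras, given by structure constants
    in a basis e_0, ..., e_(n-1):  [e_i, e_j] = \sum_k c i j k e_k. *)
Definition is_lie_algebra (n : nat) (c : 'I_n -> 'I_n -> 'I_n -> C) : Prop :=
  (forall i k, c i i k = 0) /\
  (forall i j l m,
     \sum_(k < n) (c i j k * c k l m + c j l k * c k i m + c l i k * c k j m)
     = 0).

(** The skew form A_x on g, for x in g^* (coordinates of x in the dual
    basis): (A_x)_(i j) = < x, [e_i, e_j] >. *)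
Definition formA (n : nat) (c : 'I_n -> 'I_n -> 'I_n -> C) (x : 'I_n -> C)
  : 'M[C]_n := \matrix_(i, j) \sum_(k < n) x k * c i j k.

(** Blocks: [Kron k] is a Kronecker block of size (2k-1) x (2k-1) (k >= 1);
    [Jord lam m] is a Jordan block of size 2m x 2m (m >= 1) with eigenvalue
    lam in C u {oo} (None = oo). *)
Inductive jkblock := Kron of nat | Jord of option C & nat.

Definition bsize (b : jkblock) : nat :=
  match b with Kron k => (2 * k).-1 | Jord _ m => (2 * m)%N end.

Definition bvalid (b : jkblock) : bool :=
  match b with Kron k => (0 < k)%N | Jord _ m => (0 < m)%N end.

Definition jordJ (lam : C) (p q : nat) : C :=
  if p == q then lam else if q == p.+1 then 1 else 0.

(** the skew matrix [[0, M], [-M^T, 0]] with top-left block of size h,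
    M given entrywise by M p q *)
Definition skewblk (h : nat) (M : nat -> nat -> C) (p q : nat) : C :=
  if (p < h)%N && (h <= q)%N then M p (q - h)%N
  else if (h <= p)%N && (q < h)%N then - M q (p - h)%N
  else 0.

Definition kd (p q : nat) : C := (p == q)%:R.

Definition entryA (b : jkblock) (p q : nat) : C :=
  match b with
  | Kron k => skewblk k kd p q
  | Jord (Some lam) m => skewblk m (jordJ lam) p q
  | Jord None m => skewblk m kd p q
  end.

Definition entryB (b : jkblock) (p q : nat) : C :=
  match b with
  | Kron k => skewblk k (fun p q => kd p q.+1) p q
  | Jord (Some _) m => skewblk m kd p q
  | Jord None m => skewblk m (jordJ 0) p q
  end.

Fixpoint bdiag (e : jkblock -> nat -> nat -> C) (bl : seq jkblock)
    (i j : nat) : C :=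
  match bl with
  | [::] => 0
  | b :: bl' =>
      let s := bsize b in
      if (i < s)%N && (j < s)%N then e b i j
      else if (s <= i)%N && (s <= j)%N then bdiag e bl' (i - s) (j - s)
      else 0
  end.

Definition NFA (n : nat) (bl : seq jkblock) : 'M[C]_n :=
  \matrix_(i, j) bdiag entryA bl i j.
Definition NFB (n : nat) (bl : seq jkblock) : 'M[C]_n :=
  \matrix_(i, j) bdiag entryB bl i j.

Definition JKdecomp (n : nat) (A B : 'M[C]_n) (bl : seq jkblock) : Prop :=
  [/\ all bvalid bl, sumn (map bsize bl) = n &
      exists2 P : 'M[C]_n, P \in unitmx &
        P^T *m A *m P = NFA n bl /\ P^T *m B *m P = NFB n bl].

Definition kron_of (b : jkblock) : option nat :=
  if b is Kron k then Some k else None.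
Definition kron_sizes (bl : seq jkblock) : seq nat := pmap kron_of bl.

Definition eig_of (b : jkblock) : option (option C) :=
  if b is Jord l _ then Some l else None.
Definition eigs (bl : seq jkblock) : seq (option C) := undup (pmap eig_of bl).

Definition jtuple (bl : seq jkblock) (l : option C) : seq nat :=
  sort geq (pmap (fun b => if b is Jord l' m then
                             (if l' == l then Some m else None)
                           else None) bl).

Definition jtuples (bl : seq jkblock) : seq (seq nat) :=
  map (jtuple bl) (eigs bl).

Definition zariski_open (N : nat) (U : ('I_N -> C) -> Prop) : Prop :=
  exists S : pred (mpoly.mpoly N C),
    forall v, U v <-> exists2 p, S p & mpoly.meval v p != 0.

(** a point of g^* x g^* = C^(n+n) *)
Definition fstpt (n : nat) (v : 'I_(n + n) -> C) : 'I_n -> C :=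
  fun i => v (lshift n i).
Definition sndpt (n : nat) (v : 'I_(n + n) -> C) : 'I_n -> C :=
  fun i => v (rshift n i).

Definition JKinvariants (n : nat) (c : 'I_n -> 'I_n -> 'I_n -> C)
    (ks : seq nat) (js : seq (seq nat)) : Prop :=
  exists U : ('I_(n + n) -> C) -> Prop,
    [/\ zariski_open U, exists v, U v &
        forall v, U v -> exists bl,
          [/\ JKdecomp (formA c (fstpt v)) (formA c (sndpt v)) bl,
              perm_eq (kron_sizes bl) ks & perm_eq (jtuples bl) js]].

(** a (nonincreasingly sorted) Jordan tuple has multiple maxima *)
Definition multmax (t : seq nat) : bool :=
  (1 < size t)%N && (nth 0%N t 0 == nth 0%N t 1).

(* Main.v *)
Require Import Defs.
From HB Require Import structures.
From mathcomp Require Import all_boot all_algebra.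
From mathcomp Require Import complex Rstruct ring.
From mathcomp Require mpoly.

(** Write A_x for the skew form of x. A single 1 x 1 Kronecker block makes the
    generic kernel of A_x constant, hence central; it is spanned by some z. Fix a
    generic pair (x, a), put B = A_a, A = A_x and let M be the minimal polynomial of
    the pencil on g / z, so that (s B - A) Q(s) = M(s) B for a polynomial matrix Q.
    If l is an eigenvalue with largest block size k + 1, then BQ(l) is, up to a
    scalar, the leading coefficient of the inverse of s B - A at s = l, and its rank
    is twice the number of blocks of the largest size.

    Since the Jordan type is constant near (x, a), M stays divisible by
    (s - l)^k to first order along x + e u, and differentiating the resolvent
    identity shows that the coefficient of (s - l)^k in Q^T A_u Q is mu(u) BQ(l) for a
    linear functional mu. The Jacobi identity (closedness of the inverse 2-form on the
    leaves z = const) gives theta /\ BQ(l) = 0 with theta(xi) = mu(B xi). Two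
    blocks of the largest size give BQ(l) rank at least 4, hence theta = 0, i.e. mu
    is proportional to z. But mu(a) <> 0 and mu(x - l a) = 0, so l = z(x) / z(a):
    only one eigenvalue can have multiple maxima. *)

Set Implicit Arguments.
Unset Strict Implicit.
Unset Printing Implicit Defensive.

Import GRing.Theory.
Local Open Scope ring_scope.

(** * Dependencies over polynomial rings *)

Section Polynomials.
Variable F : fieldType.
Hypothesis char0 : forall k, k.+1%:R != 0 :> F.

Lemma nat_inj_char0 : injective (fun k => k%:R : F).
Proof.
move=> i j; wlog le_ij: i j / (i <= j)%N.
  by move=> H E; case/orP: (leq_total i j) => /H -> //.
move=> E; apply/eqP; rewrite eqn_leq le_ij /= leqNgt; apply/negP=> lt_ij.
have := char0 (j - i).-1; rewrite prednK ?subn_gt0 // natrB //=.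
by rewrite /= E subrr eqxx.
Qed.

(** In characteristic 0 the scalars 0, 1, ..., [size p - 1] are distinct, and they outnumber the
    roots of [p]. *)
Lemma nonroot_exists (p : {poly F}) : p != 0 -> exists e, p.[e] != 0.
Proof.
move=> p0; pose s := [seq k%:R : F | k <- iota 0 (size p)].
have us : uniq s by rewrite map_inj_uniq ?iota_uniq //; apply: nat_inj_char0.
have /allPn [e _ He] : ~~ all (root p) s.
  apply/negP=> Hs; have := max_poly_roots p0 Hs us.
  by rewrite size_map size_iota ltnn.
by exists e.
Qed.

Lemma clear_denominators (I : finType) (f : I -> {fraction {poly F}}) :
  exists2 q : {poly F}, q != 0 &
    exists g : I -> {poly F}, forall i, tofrac q * f i = tofrac (g i).
Proof.
(* A representative of a fraction is a pair, which supplies a denominator for one element; the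
   family is then treated one index at a time. *)
have frE (x : {fraction {poly F}}) :
    exists d n : {poly F}, d != 0 /\ tofrac d * x = tofrac n.
  elim/quotW: x => r; exists r.2, r.1; split; first exact: denom_ratioP.
  rewrite /tofrac; unlock FracField.tofrac; rewrite !piE.
  apply/eqmodP; rewrite /= FracField.equivfE /FracField.mulf /=.
  by rewrite !numden_Ratio ?mul1r ?mulr1 ?oner_neq0 ?denom_ratioP // mulrC.
suff H (s : seq I) : exists2 q : {poly F}, q != 0 &
    exists g : I -> {poly F}, forall i, i \in s -> tofrac q * f i = tofrac (g i).
  have [q q0 [g Hg]] := H (enum I).
  by exists q => //; exists g => i; apply: Hg; rewrite mem_enum.
elim: s => [|j s [q q0 [g Hg]]].
  by exists 1; rewrite ?oner_neq0 //; exists (fun _ => 0).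
have [d [m [d0 E]]] := frE (f j).
exists (q * d); first by rewrite mulf_neq0.
exists (fun i => if i == j then q * m else d * g i) => i; rewrite inE.
case: eqP => [-> _|_ /= /Hg Ei]; first by rewrite tofracM -mulrA E -tofracM.
by rewrite mulrC tofracM (mulrC (tofrac q)) mulrCA (mulrC (f i)) Ei -tofracM.
Qed.

End Polynomials.

Section Specialization.
Variable F : fieldType.
Hypothesis char0 : forall k, k.+1%:R != 0 :> F.

(** Pulls out the largest common power of the variable. As long as all members vanish at 0 the whole
    family is divided by ['X], which lowers the size of the nonzero member [w i0], so this stops. *)
Lemma nonzero_at0 (I : finType) (w : I -> {poly F}) (i0 : I) : w i0 != 0 ->
  exists k, exists2 w' : I -> {poly F},
    (forall i, w i = 'X^k * w' i) & exists i, (w' i).[0] != 0.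
Proof.
move: {2}(size (w i0)) (leqnn (size (w i0))) => m.
elim: m w => [|m IHm] w Hm w0; first by rewrite leqn0 size_poly_eq0 (negPf w0) in Hm.
case: (boolP [exists i, (w i).[0] != 0]) => [/existsP [i Hi]|].
  by exists 0%N, w; [move=> j; rewrite mul1r | exists i].
rewrite negb_exists => /forallP H.
have Hw i : w i = 'X * (w i %/ 'X).
  by rewrite mulrC divpK // -['X]subr0 dvdp_XsubCl rootE; have := H i; rewrite negbK.
have w0' : w i0 %/ 'X != 0 by apply: contraNneq w0 => E; rewrite Hw E mulr0.
have Hs : (size (w i0 %/ 'X)%R <= m)%N.
  have := congr1 (fun p : {poly F} => size p) (Hw i0).
  by rewrite mulrC size_mulX // => Es; rewrite Es in Hm.
have [k [w' Hw' Hn]] := IHm (fun i => w i %/ 'X) Hs w0'.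
exists k.+1, w' => // i; by rewrite Hw Hw' mulrA exprS.
Qed.

(* A linear dependency at almost all parameters lifts to the field of rational
   functions; clearing denominators and dividing by a power of the parameter
   keeps it nontrivial at 0. *)
Lemma dependency_specialization (I J : finType) (V : I -> J -> {poly F}) (q : {poly F}) :
  q != 0 ->
  (forall e, q.[e] != 0 -> exists2 w : I -> F,
     exists i, w i != 0 & forall j, \sum_i w i * (V i j).[e] = 0) ->
  exists2 w : I -> {poly F}, exists i, (w i).[0] != 0 &
    forall j, \sum_i w i * V i j = 0.
Proof.
move=> q0 Hq.
pose vI : 'I_#|I| -> I := @enum_val I predT; pose rI : I -> 'I_#|I| := enum_rank.
pose vJ : 'I_#|J| -> J := @enum_val J predT; pose rJ : J -> 'I_#|J| := enum_rank.
have vIK : cancel vI rI by apply: enum_valK.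
have rIK : cancel rI vI by apply: enum_rankK.
have rJK : cancel rJ vJ by apply: enum_rankK.
pose W : 'M[{fraction {poly F}}]_(#|I|, #|J|) :=
  \matrix_(i, j) tofrac (V (vI i) (vJ j)).
have reI (R : pzSemiRingType) (f : I -> R) : \sum_i f (vI i) = \sum_i f i.
  by rewrite (reindex vI) //=; apply: onW_bij; exists rI.
(* Independent rows would have a right inverse over the fraction field. With its denominator [d]
   cleared, it contradicts the dependency at a point where neither [q] nor [d] vanishes. *)
case: (boolP (row_free W)) => [|Wnf].
  case/row_freeP => X XW.
  have [d d0 [g Hg]] := clear_denominators (fun ji : 'I_#|J| * 'I_#|I| => X ji.1 ji.2).
  have [e] := nonroot_exists char0 (mulf_neq0 q0 d0).
  rewrite hornerM mulf_eq0 negb_or => /andP [qe de].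
  have [w [i wi] Hw] := Hq e qe.
  have E k i' : \sum_j V (vI k) (vJ j) * g (j, i') = d *+ (k == i').
    apply/eqP; rewrite -tofrac_eq raddf_sum; apply/eqP.
    transitivity (tofrac d * (W *m X) k i').
      rewrite mxE mulr_sumr; apply: eq_bigr => j _.
      by rewrite mxE /= mulrCA (Hg (j, i')) -tofracM.
    by rewrite XW mxE tofracMn mulr_natr.
  have : \sum_k w (vI k) * (\sum_j V (vI k) (vJ j) * g (j, rI i)).[e] = w i * d.[e].
    under eq_bigr => k _ do rewrite E.
    rewrite (bigD1 (rI i)) //= eqxx rIK big1 ?addr0 //.
    by move=> k /negPf Hk; rewrite Hk horner0 mulr0.
  under eq_bigr => k _ do rewrite horner_sum mulr_sumr.
  rewrite exchange_big big1 /=.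
    by move/eqP; rewrite eq_sym mulf_eq0 (negPf wi) (negPf de).
  move=> j _; under eq_bigr => k _ do rewrite hornerM mulrA.
  rewrite -mulr_suml (reI _ (fun i => w i * (V i (vJ j)).[e])) Hw.
  by rewrite mul0r.
have [u u0 uW] : exists2 u : 'rV_#|I|, u != 0 & u *m W = 0.
  move: Wnf; rewrite -kermx_eq0 => /rowV0Pn [u /sub_kermxP Hu u0].
  by exists u.
have [d d0 [g Hg]] := clear_denominators (fun i => u 0 (rI i)).
have [i ui] : exists i, u 0 i != 0 by apply/rV0Pn.
have gi : g (vI i) != 0.
  apply/eqP=> g0; have /eqP := Hg (vI i).
  by rewrite vIK g0 tofrac0 mulf_eq0 tofrac_eq0 (negPf d0) (negPf ui).
have [k [w Hw wn]] := nonzero_at0 gi.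
exists w => // j.
have : \sum_i g i * V i j = 0.
  apply/eqP; rewrite -tofrac_eq0 raddf_sum; apply/eqP.
  transitivity (tofrac d * (u *m W) 0 (rJ j)); last by rewrite uW mxE mulr0.
  rewrite mxE mulr_sumr -(reI _ (fun i => tofrac (g i * V i j))).
  by apply: eq_bigr => l _; rewrite tofracM -Hg mxE mulrA rJK vIK.
under eq_bigr => l _ do rewrite Hw -mulrA.
by rewrite -mulr_sumr => /eqP; rewrite mulf_eq0 expf_eq0 polyX_eq0 andbF /= => /eqP.
Qed.

End Specialization.

(** * Multiple roots along a family *)

Section Roots.
Variable F : fieldType.
Hypothesis char0 : forall k, k.+1%:R != 0 :> F.
Implicit Types (s : seq F) (m : F -> nat) (M K H : {poly F}).

Lemma prod_XsubC_factor s m l : uniq s -> l \in s ->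
  exists2 g, \prod_(i <- s) ('X - i%:P) ^+ m i = ('X - l%:P) ^+ m l * g & g.[l] != 0.
Proof.
move=> us ls; exists (\prod_(i <- rem l s) ('X - i%:P) ^+ m i); first exact: big_rem.
rewrite horner_prod prodf_seq_neq0; apply/allP=> i; rewrite mem_rem_uniq // inE.
by case/andP=> il _; rewrite horner_exp hornerXsubC expf_neq0 // subr_eq0 eq_sym.
Qed.

Lemma dvdp_prod_XsubC s m f : uniq s ->
  (forall l, l \in s -> ('X - l%:P) ^+ m l %| f) ->
  \prod_(i <- s) ('X - i%:P) ^+ m i %| f.
Proof.
elim: s => [|l s IHs] /=; first by rewrite big_nil dvd1p.
case/andP=> ls us Hf; rewrite big_cons Gauss_dvdp.
  rewrite Hf ?mem_head // IHs // => i Hi; by rewrite Hf // inE Hi orbT.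
apply: coprimep_expl; rewrite coprimep_sym coprimep_XsubC rootE horner_prod prodf_seq_neq0.
apply/allP=> i Hi /=; rewrite horner_exp hornerXsubC expf_neq0 // subr_eq0.
by apply: contraNneq ls => ->.
Qed.

Lemma size_prod_XsubC_exp s m :
  size (\prod_(i <- s) ('X - i%:P) ^+ m i) = (\sum_(i <- s) m i).+1.
Proof.
elim: s => [|l s IHs]; first by rewrite !big_nil size_poly1.
rewrite !big_cons size_mul ?IHs ?size_exp_XsubC ?addSn ?addnS //=.
  by rewrite expf_neq0 // polyXsubC_eq0.
by rewrite -size_poly_gt0 IHs.
Qed.

(** The logarithmic derivative with cleared denominators: [K] is the sum of [m l] times the product
    of the other linear factors. The identity is linear in the pair of the radical and [K], with
    degrees bounded by the number of roots; this is what can be lifted along a family. *)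
Lemma deriv_prod_XsubC s m : exists2 K : {poly F}, (size K <= size s)%N &
  (\prod_(i <- s) ('X - i%:P) ^+ m i)^`() * \prod_(i <- s) ('X - i%:P) =
  \prod_(i <- s) ('X - i%:P) ^+ m i * K.
Proof.
elim: s => [|l s [K sK EK]].
  by exists 0; rewrite ?size_poly0 // !big_nil derivC mul0r mulr0.
exists ((m l)%:R *: \prod_(i <- s) ('X - i%:P) + ('X - l%:P) * K).
  rewrite (leq_trans (size_polyD _ _)) // geq_max; apply/andP; split.
    rewrite (leq_trans (size_scale_leq _ _)) //.
    by rewrite (size_prod_XsubC s id).
  by rewrite (leq_trans (size_polyMleq _ _)) // size_XsubC.
rewrite !big_cons derivM deriv_exp derivXsubC mul1r.
set P := \prod_(j <- s) ('X - j%:P) ^+ _ in EK *; set H := \prod_(j <- s) _ in EK *.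
set t := 'X - l%:P.
rewrite mulrDl -[X in _ + X]mulrA (mulrCA P^`()) EK mulrDr; congr (_ + _); last first.
  by rewrite !mulrA -[_ * t * P]mulrA (mulrC t P) mulrA.
rewrite -!mulrA mulrnAl -mulrnAr scaler_nat.
case: (m l) => [|k]; first by rewrite !mulr0n !mulr0.
by rewrite /= exprSr !mulrnAr -!mulrA (mulrCA P).
Qed.

(** After cancelling [('X - l%:P) ^+ k], evaluation at [l] leaves [(k + 1) g(l) H(l) = 0]. *)
Lemma root_log_derivative M K H g l k : M != 0 ->
  M = ('X - l%:P) ^+ k.+1 * g -> g.[l] != 0 -> M * K = M^`() * H -> root H l.
Proof.
move=> M0 EM gl E.
have tk0 : ('X - l%:P) ^+ k != 0 by rewrite expf_neq0 // polyXsubC_eq0.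
have E' : ('X - l%:P) * g * K = (g *+ k.+1 + ('X - l%:P) * g^`()) * H.
  apply: (mulfI tk0); rewrite !mulrA -exprSr -EM E EM derivM deriv_exp derivXsubC mul1r.
  by congr (_ * _); rewrite mulrDr !mulrA -exprSr mulrnAl mulrnAr.
move/(congr1 (fun p => p.[l])): E'; rewrite !(hornerXsubC, hornerM, hornerD, hornerMn).
rewrite subrr !mul0r addr0 => /esym /eqP.
rewrite mulf_eq0 -mulr_natr mulf_eq0 (negPf gl) (negPf (char0 k)) /=.
by rewrite rootE.
Qed.

(** [H] vanishes at every point of [s], and its degree is at most the number of these points, so no
    root can be double. *)
Lemma simple_root_log_derivative s m M K H c : uniq s ->
  (forall i, i \in s -> (0 < m i)%N) -> c != 0 ->
  M = c *: \prod_(i <- s) ('X - i%:P) ^+ m i -> H != 0 -> (size H <= (size s).+1)%N ->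
  M * K = M^`() * H ->
  forall l, l \in s -> exists2 h, H = ('X - l%:P) * h & h.[l] != 0.
Proof.
move=> us ms c0 EM H0 sH E.
have M0 : M != 0 by rewrite EM scaler_eq0 negb_or c0 -size_poly_gt0 size_prod_XsubC_exp.
have rH i : i \in s -> root H i.
  move=> Hi; have [g Eg gi] := prod_XsubC_factor m us Hi.
  apply: (@root_log_derivative M K H (c *: g) i (m i).-1 M0) => //.
    by rewrite prednK ?ms // EM Eg scalerAr.
  by rewrite hornerZ mulf_neq0.
move=> l Hl; have /factor_theorem [h Eh] := rH l Hl; rewrite mulrC in Eh.
exists h => //; apply/negP=> /eqP hl.
have h0 : h != 0 by apply: contraNneq H0 => h0; rewrite Eh h0 mulr0.
have /(max_poly_roots h0) : all (root h) s.
  apply/allP=> i Hi; have := rH i Hi; rewrite Eh rootM root_XsubC.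
  by case/orP=> // /eqP ->; rewrite rootE hl.
move/(_ us); rewrite ltnNge; case/negP.
by move: sH; rewrite Eh mulrC size_Mmonic ?monicXsubC // size_XsubC addn2.
Qed.

(* If [M1] vanished at [l] to an order [r < k] only, [M1 * K0 - M1' * H0] would have
   order exactly [r], its leading coefficient carrying the factor [k.+1 - r]. *)
Lemma dvdp_first_variation M0 M1 K0 K1 H0 H1 g h l k :
  M0 = ('X - l%:P) ^+ k.+1 * g -> g.[l] != 0 -> H0 = ('X - l%:P) * h -> h.[l] != 0 ->
  M0 * K0 = M0^`() * H0 ->
  M1 * K0 + M0 * K1 = M1^`() * H0 + M0^`() * H1 ->
  ('X - l%:P) ^+ k %| M1.
Proof.
set t := 'X - l%:P => EM gl EH hl E0 E1.
have t0 : t != 0 by rewrite polyXsubC_eq0.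
have dM0 : M0^`() = t ^+ k * (g *+ k.+1 + t * g^`()).
  rewrite EM derivM deriv_exp derivXsubC mul1r.
  by rewrite mulrDr mulrA -exprSr mulrnAl mulrnAr.
have EK : g * K0 = (g *+ k.+1 + t * g^`()) * h.
  apply: (mulfI (expf_neq0 k.+1 t0)).
  by rewrite mulrA -EM E0 dM0 EH exprSr -!mulrA; congr (_ * _); rewrite mulrCA.
have Kl : K0.[l] = h.[l] *+ k.+1.
  move/(congr1 (fun p => p.[l])): EK.
  rewrite !(hornerXsubC, hornerM, hornerD, hornerMn) subrr mul0r addr0.
  by rewrite mulrnAl -mulrnAr => /(mulfI gl).
have [-> | M10] := eqVneq M1 0; first exact: dvdp0.
have [r [b bl Eb]] := multiplicity_XsubC M1 l; rewrite M10 /= in bl.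
rewrite Eb mulrC; have [le_kr | lt_rk] := leqP k r.
  by apply: dvdp_mulr; apply: dvdp_exp2l.
have dv : t ^+ k %| t ^+ r * (b * K0 - (b *+ r + t * b^`()) * h).
  have -> : t ^+ r * (b * K0 - (b *+ r + t * b^`()) * h) = M0^`() * H1 - M0 * K1.
    transitivity (M1 * K0 - M1^`() * H0); last first.
      by apply/eqP; rewrite subr_eq addrAC eq_sym subr_eq eq_sym E1 addrC.
    rewrite Eb derivM deriv_exp derivXsubC mul1r EH mulrBr; congr (_ - _).
      by rewrite mulrA (mulrC b).
    rewrite mulrA; rewrite [RHS]mulrA; congr (_ * _).
    rewrite -/t mulrDr [RHS]mulrDl [RHS]addrC; congr (_ + _); last first.
      by ring.
    case: r {Eb lt_rk} => [|r]; first by rewrite !mulr0n !(mulr0, mul0r).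
    by rewrite /= mulrnAr [in RHS]mulrnAr mulrnAl exprSr [in LHS]mulrC mulrA.
  apply: dvdp_sub; first by rewrite dM0 -mulrA dvdp_mulr.
  by rewrite EM exprSr -!mulrA dvdp_mulr.
move: dv; rewrite -(subnKC lt_rk) addSnnS exprD dvdp_mul2l ?expf_neq0 // exprS.
move/(dvdp_trans (dvdp_mulr _ (dvdpp _))); rewrite dvdp_XsubCl rootE.
rewrite !(hornerXsubC, hornerD, hornerN, hornerM, hornerMn) subrr mul0r addr0 Kl.
rewrite mulrnAr mulrnAl -mulrnBr; last by rewrite ltnW // ltnS ltnW.
rewrite subSn 1?ltnW // -mulr_natr !mulf_eq0 (negPf hl) (negPf (char0 _)) orbF orbF.
by move: bl; rewrite rootE => /negPf ->.
Qed.

End Roots.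

(** * Brackets and the Jacobi identity *)

Section Bracket.
Variables (R : comNzRingType) (n : nat) (c : 'I_n -> 'I_n -> 'I_n -> R).

(** Stated over any commutative ring: it serves over the base field and, with constant structure
    constants, over polynomials in the spectral parameter. *)
Definition formR (x : 'rV[R]_n) : 'M[R]_n := \matrix_(i, j) \sum_k x 0 k * c i j k.

Definition bracket (y z : 'cV[R]_n) : 'rV[R]_n :=
  \row_k \sum_i \sum_j y i 0 * z j 0 * c i j k.

Definition jacobi := forall i j l m, \sum_(k < n)
  (c i j k * c k l m + c j l k * c k i m + c l i k * c k j m) = 0.

Lemma formR_bracket u y z : (y^T *m formR u *m z) 0 0 = \sum_k u 0 k * bracket y z 0 k.
Proof.
under [RHS]eq_bigr => k _ do rewrite mxE mulr_sumr.
rewrite exchange_big mxE /=.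
under eq_bigr => j _ do rewrite mxE mulr_suml.
rewrite exchange_big; apply: eq_bigr => i _ /=.
under [RHS]eq_bigr => k _ do rewrite mulr_sumr.
rewrite exchange_big; apply: eq_bigr => j _ /=.
rewrite !mxE mulr_sumr mulr_suml; apply: eq_bigr => k _; ring.
Qed.

(** The three terms are [x] paired with the double brackets [[[y, z], t]] and its cyclic shifts.
    Expanded in coordinates and reindexed, they differ only by a cyclic shift of the indices of
    [w]. *)
Lemma jacobi_form (Hc : jacobi) x y z t :
  (bracket y z *m formR x *m t) 0 0 + (bracket z t *m formR x *m y) 0 0
    + (bracket t y *m formR x *m z) 0 0 = 0.
Proof.
pose w i j l := \sum_m x 0 m * \sum_k c i j k * c k l m.
have w0 i j l : w i j l + w j l i + w l i j = 0.
  rewrite /w -!big_split big1 //= => m _; rewrite -!mulrDr -!big_split /=.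
  by rewrite (Hc i j l m) mulr0.
have E (p q r : 'cV[R]_n) : (bracket p q *m formR x *m r) 0 0 =
    \sum_i \sum_j \sum_l p i 0 * q j 0 * r l 0 * w i j l.
  rewrite mxE.
  transitivity (\sum_l \sum_i \sum_j p i 0 * q j 0 * r l 0 * w i j l).
    apply: eq_bigr => l _; rewrite mxE mulr_suml.
    transitivity (\sum_k \sum_i \sum_j p i 0 * q j 0 * c i j k * formR x k l * r l 0).
      apply: eq_bigr => k _; rewrite mxE !mulr_suml; apply: eq_bigr => i _.
      by rewrite !mulr_suml.
    rewrite exchange_big; apply: eq_bigr => i _; rewrite exchange_big.
    apply: eq_bigr => j _; rewrite /w mulr_sumr.
    under [RHS]eq_bigr => m _ do rewrite mulr_sumr mulr_sumr.
    rewrite [RHS]exchange_big; apply: eq_bigr => k _.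
    rewrite mxE mulr_sumr mulr_suml; apply: eq_bigr => m _ /=; ring.
  rewrite exchange_big; apply: eq_bigr => i _; rewrite exchange_big.
  by apply: eq_bigr.
have E2 : \sum_i \sum_j \sum_l z i 0 * t j 0 * y l 0 * w i j l =
    \sum_i \sum_j \sum_l y i 0 * z j 0 * t l 0 * w j l i.
  rewrite [RHS]exchange_big; apply: eq_bigr => i _; rewrite [RHS]exchange_big.
  by apply: eq_bigr => j _; apply: eq_bigr => l _ /=; ring.
have E3 : \sum_i \sum_j \sum_l t i 0 * y j 0 * z l 0 * w i j l =
    \sum_i \sum_j \sum_l y i 0 * z j 0 * t l 0 * w l i j.
  rewrite [LHS]exchange_big; apply: eq_bigr => i _; rewrite [LHS]exchange_big.
  by apply: eq_bigr => j _; apply: eq_bigr => l _ /=; ring.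
rewrite !E E2 E3 -!big_split big1 //= => i _; rewrite -!big_split big1 //= => j _.
by rewrite -!big_split big1 //= => l _; rewrite -!mulrDr w0 mulr0.
Qed.
End Bracket.

(** * Resolvents *)

(** Iteration gives powers for every size [n], including 0. *)
Definition mxpow (R : pzRingType) n (L : 'M[R]_n) k := iter k (mulmx L) 1%:M.

Lemma mxpowSr (R : pzRingType) n (L : 'M[R]_n) k : mxpow L k.+1 = mxpow L k *m L.
Proof.
elim: k => [|k IHk]; first by rewrite /mxpow /= mulmx1 mul1mx.
by rewrite -[mxpow L k.+2]/(L *m mxpow L k.+1) {1}IHk mulmxA.
Qed.

(* [divdiff z L k] is [(z ^+ k - L ^+ k) / (z - L)]. *)
Fixpoint divdiff (R : comNzRingType) n (z : R) (L : 'M[R]_n) k : 'M[R]_n :=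
  if k is k'.+1 then mxpow L k' + z *: divdiff z L k' else 0.

(** With [p] the polynomial with coefficients [m], this is [(p(z) - p(L)) / (z - L)]; when
    [p(L) = 0] it is [p(z)] times the inverse of [z - L], without denominators. *)
Definition resolvent (R : comNzRingType) n (z : R) (L : 'M[R]_n) D (m : nat -> R) :=
  \sum_(k < D) m k *: divdiff z L k.

(** Since [A = B L], the product of [z B - A] with [divdiff z L k] telescopes to
    [z ^+ k B - B L ^+ k], and the relation removes the second terms. Only [S] acting as an inverse
    of [B] on the image of [A] is used, so [B] may be degenerate. *)
Lemma resolventE (R : comNzRingType) n (z : R) (B S A : 'M[R]_n) D (m : nat -> R) :
  B *m S *m A = A -> \sum_(k < D) m k *: (B *m mxpow (S *m A) k) = 0 ->
  (z *: B - A) *m resolvent z (S *m A) D m = (\sum_(k < D) m k * z ^+ k) *: B.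
Proof.
move=> BSA rel; set L := S *m A in rel *.
have E k : (z *: B - A) *m divdiff z L k = z ^+ k *: B - B *m mxpow L k.
  have AE : A = B *m L by rewrite mulmxA BSA.
  elim: k => [|k IHk]; first by rewrite /= mulmx0 scale1r /mxpow /= mulmx1 subrr.
  rewrite [divdiff _ _ _]/= mulmxDr -scalemxAr IHk mulmxBl -scalemxAl scalerBr.
  rewrite scalerA -exprS {1}AE -[B *m L *m _]mulmxA -[mxpow L k.+1]/(L *m mxpow L k).
  by rewrite addrC addrA subrK.
rewrite mulmx_sumr; under eq_bigr => k _ do rewrite -scalemxAr E scalerBr scalerA.
by rewrite sumrB rel subr0 scaler_suml.
Qed.

Lemma map_mxpow (R R' : comNzRingType) (f : {rmorphism R -> R'}) n (L : 'M[R]_n) k :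
  map_mx f (mxpow L k) = mxpow (map_mx f L) k.
Proof.
elim: k => [|k IHk]; first by rewrite /mxpow /= map_mx1.
by rewrite -[mxpow L _]/(L *m mxpow L k) map_mxM IHk.
Qed.

Lemma map_resolvent (R R' : comNzRingType) (f : {rmorphism R -> R'}) n z (L : 'M[R]_n) D m :
  map_mx f (resolvent z L D m) = resolvent (f z) (map_mx f L) D (f \o m).
Proof.
rewrite /resolvent map_mx_sum; apply: eq_bigr => k _; rewrite map_mxZ; congr (_ *: _).
elim: (nat_of_ord k) => [|j IHj] /=; first by rewrite map_mx0.
by rewrite map_mxD map_mxZ IHj map_mxpow.
Qed.

(* The common pattern behind differentiating [X *m Q = M *: B], with [X] and [B]
   skew, in the spectral parameter and along a variation of the form. *)
Lemma skew_resolvent_variation (R : idomainType) n (X B Q X' Q' : 'M[R]_n) (M M' : R) :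
  X^T = - X -> B^T = - B -> M != 0 -> X *m Q = M *: B ->
  X' *m Q + X *m Q' = M' *: B ->
  Q^T *m X' *m Q = M' *: (B *m Q) - M *: (B *m Q').
Proof.
move=> Xs Bs M0 E E'.
have QX : Q^T *m X = M *: B.
  have := congr1 trmx E; rewrite trmx_mul linearZ /= Xs Bs mulmxN scalerN.
  exact: oppr_inj.
(* Multiplied by [M], both sides become [Q^T X Q]; [M] can be cancelled over a domain. *)
have QB : Q^T *m B = B *m Q.
  apply/matrixP=> i j; apply: (mulfI M0).
  have /matrixP /(_ i j) : M *: (Q^T *m B) = M *: (B *m Q).
    by rewrite scalemxAr -E mulmxA QX -scalemxAl.
  by rewrite mxE [RHS]mxE.
have -> : Q^T *m X' *m Q = Q^T *m (X' *m Q) by rewrite mulmxA.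
have -> : X' *m Q = M' *: B - X *m Q' by rewrite -E' addrK.
by rewrite mulmxBr -scalemxAr QB mulmxA QX -scalemxAl.
Qed.

(** * First-order expansion in a deformation parameter *)

Section FirstOrder.
Variable F : fieldType.

(** In [{poly {poly F}}] the outer variable is the spectral parameter and the inner one the
    deformation parameter [e]; [ev0] and [ev1] take the coefficients of [e ^ 0] and [e ^ 1]. *)
Definition ev0 : {poly {poly F}} -> {poly F} := map_poly (horner_eval 0).
Definition ev1 : {poly {poly F}} -> {poly F} := map_poly (coefp 1).
HB.instance Definition _ := GRing.RMorphism.copy ev0 (map_poly (horner_eval (0 : F))).
HB.instance Definition _ := GRing.Additive.copy ev1 (map_poly (coefp 1 : {poly F} -> F)).

Lemma coef_ev0 P k : (ev0 P)`_k = (P`_k)`_0.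
Proof. by rewrite coef_map /= /horner_eval horner_coef0. Qed.

Lemma coef_ev1 P k : (ev1 P)`_k = (P`_k)`_1.
Proof. by rewrite coef_map_id0 //= coef0. Qed.

Lemma ev1M P Q : ev1 (P * Q) = ev1 P * ev0 Q + ev0 P * ev1 Q.
Proof.
apply/polyP=> k; rewrite coef_ev1 coefD !coefM coef_sum -big_split.
apply: eq_bigr => i _ /=; rewrite coefM !big_ord_recl big_ord0 /= addr0.
by rewrite !coef_ev0 !coef_ev1 addrC.
Qed.

Lemma ev1_deriv P : ev1 P^`() = (ev1 P)^`().
Proof.
by apply/polyP=> k; rewrite coef_ev1 !coef_deriv coefMn coef_ev1.
Qed.

Lemma ev0_deriv P : ev0 P^`() = (ev0 P)^`().
Proof.
by apply/polyP=> k; rewrite coef_ev0 !coef_deriv coefMn coef_ev0.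
Qed.

Lemma map_ev1_mulmx m n p (P : 'M[{poly {poly F}}]_(m, n)) (Q : 'M_(n, p)) :
  map_mx ev1 (P *m Q) = map_mx ev1 P *m map_mx ev0 Q + map_mx ev0 P *m map_mx ev1 Q.
Proof.
apply/matrixP=> i j; rewrite !mxE raddf_sum -big_split.
by apply: eq_bigr => k _; rewrite /= ev1M !mxE.
Qed.

Local Notation lift := (map_mx (polyC : F -> {poly F})).
Local Notation lift2 := (map_mx (polyC : {poly F} -> {poly {poly F}})).

Definition specpoly D (m : nat -> {poly F}) : {poly {poly F}} := \sum_(k < D) m k *: 'X^k.

(** The resolvent identity holds for the whole family [A + e U]; the two conclusions are its
    coefficients of order 0 and 1 in [e]. As [B] is fixed, the pencil varies by [- U] alone. *)
Lemma resolvent_first_variation n (A B S U : 'M[F]_n) D (m : nat -> {poly F}) :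
  B *m S *m A = A -> B *m S *m U = U ->
  let Ae := lift A + 'X *: lift U in
  \sum_(k < D) m k *: (lift B *m mxpow (lift S *m Ae) k) = 0 ->
  let Q0 := resolvent 'X (lift (S *m A)) D (fun k => ((m k)`_0)%:P) in
  ('X *: lift B - lift A) *m Q0 = ev0 (specpoly D m) *: lift B /\
  exists Q1, - lift U *m Q0 + ('X *: lift B - lift A) *m Q1
             = ev1 (specpoly D m) *: lift B.
Proof.
move=> BSA BSU Ae rel Q0.
have BSAe : lift B *m lift S *m Ae = Ae.
  by rewrite -map_mxM mulmxDr -scalemxAr -!map_mxM BSA BSU.
have BSAe2 : lift2 (lift B) *m lift2 (lift S) *m lift2 Ae = lift2 Ae.
  by rewrite -{2}BSAe 2!map_mxM.
have rel2 : \sum_(k < D) (polyC \o m) k *: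
    (lift2 (lift B) *m mxpow (lift2 (lift S) *m lift2 Ae) k) = 0.
  have := congr1 lift2 rel; rewrite map_mx_sum map_mx0 => {2}<-.
  by apply: eq_bigr => k _; rewrite map_mxZ map_mxM map_mxpow map_mxM.
have := resolventE 'X BSAe2 rel2; set Q := resolvent _ _ _ _.
have -> : \sum_(k < D) (polyC \o m) k * 'X^k = specpoly D m.
  by apply: eq_bigr => k _; rewrite mul_polyC.
move=> E.
have e00 (p : {poly F}) : ev0 p%:P = (p`_0)%:P.
  by apply/polyP=> k; rewrite coef_ev0 !coefC; case: eqP => // _; rewrite coef0.
have e10 (p : {poly F}) : ev1 p%:P = (p`_1)%:P.
  by apply/polyP=> k; rewrite coef_ev1 !coefC; case: eqP => // _; rewrite coef0.
have e0X : ev0 'X = 'X by rewrite /ev0 map_polyX.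
have e1X : ev1 'X = 0.
  by apply/polyP=> k; rewrite coef_ev1 coefX coef0; case: eqP => _; rewrite ?coef0 ?coef1.
have e0B (Y : 'M[F]_n) : map_mx ev0 (lift2 (lift Y)) = lift Y.
  by apply/matrixP=> i j; rewrite !mxE e00 coefC.
have e1B (Y : 'M[F]_n) : map_mx ev1 (lift2 (lift Y)) = 0.
  by apply/matrixP=> i j; rewrite !mxE e10 coefC.
have e0A : map_mx ev0 (lift2 Ae) = lift A.
  apply/matrixP=> i j; rewrite !mxE e00 coefD coefXM coefC eqxx /=.
  by rewrite addr0.
have e1A : map_mx ev1 (lift2 Ae) = lift U.
  apply/matrixP=> i j; rewrite !mxE e10 coefD coefXM !coefC /= add0r.
  by [].
have EQ0 : map_mx ev0 Q = Q0.
  rewrite /Q map_resolvent /= e0X map_mxM e0B e0A -map_mxM.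
  by apply: eq_bigr => k _ /=; rewrite e00.
have e0Y : map_mx ev0 ('X *: lift2 (lift B) - lift2 Ae) = 'X *: lift B - lift A.
  by rewrite map_mxB map_mxZ /= e0X e0B e0A.
have e1Y : map_mx ev1 ('X *: lift2 (lift B) - lift2 Ae) = - lift U.
  rewrite map_mxB /= e1A; apply/matrixP=> i j; rewrite !mxE ev1M e1X.
  by rewrite e10 coefC mul0r mulr0 !add0r.
have e1Z P (Y : 'M[F]_n) : map_mx ev1 (P *: lift2 (lift Y)) = ev1 P *: lift Y.
  apply/matrixP=> i j; rewrite !mxE ev1M e10 e00 !coefC /= mulr0 addr0 //.
split; first by rewrite -EQ0 -e0Y -map_mxM E map_mxZ e0B.
exists (map_mx ev1 Q).
by rewrite -EQ0 -e1Y -e0Y -map_ev1_mulmx E e1Z.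
Qed.

End FirstOrder.

(** * The leading coefficient of the resolvent *)

Section LeadingCoefficient.
Variable F : fieldType.
Hypothesis char0 : forall k, k.+1%:R != 0 :> F.

Local Notation lift := (map_mx (polyC : F -> {poly F})).

Definition taylor_coef (l : F) k (p : {poly F}) := (p \Po ('X + l%:P))`_k.

Lemma taylor_coefD l k p q : taylor_coef l k (p + q) = taylor_coef l k p + taylor_coef l k q.
Proof. by rewrite /taylor_coef comp_polyD coefD. Qed.

Lemma taylor_coef_sum l k (I : finType) (f : I -> {poly F}) :
  taylor_coef l k (\sum_i f i) = \sum_i taylor_coef l k (f i).
Proof. by rewrite /taylor_coef rmorph_sum coef_sum. Qed.

Lemma taylor_coefZ l k (b : F) p : taylor_coef l k (b%:P * p) = b * taylor_coef l k p.
Proof. by rewrite /taylor_coef rmorphM /= comp_polyC coefCM. Qed.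

Lemma taylor_coef_exp l k p : taylor_coef l k (('X - l%:P) ^+ k * p) = p.[l].
Proof.
rewrite /taylor_coef rmorphM rmorphXn /= comp_polyB comp_polyX comp_polyC addrK.
by rewrite coefXnM ltnn subnn -horner_coef0 horner_comp !hornerE.
Qed.

Lemma taylor_coef_expS l k p : taylor_coef l k (('X - l%:P) ^+ k.+1 * p) = 0.
Proof.
rewrite /taylor_coef rmorphM rmorphXn /= comp_polyB comp_polyX comp_polyC addrK.
by rewrite coefXnM ltnSn.
Qed.

Lemma deriv_mulmx m n p (P : 'M[{poly F}]_(m, n)) (Q : 'M_(n, p)) :
  map_mx (@deriv F) (P *m Q) =
  map_mx (@deriv F) P *m Q + P *m map_mx (@deriv F) Q.
Proof.
apply/matrixP=> i j; rewrite !mxE raddf_sum -big_split.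
by apply: eq_bigr => k _; rewrite /= derivM !mxE.
Qed.

Variables (n : nat) (c : 'I_n -> 'I_n -> 'I_n -> F).
Let cP i j k := (c i j k)%:P.

Lemma lift_formR u : lift (formR c u) = formR cP (lift u).
Proof.
apply/matrixP=> i j; rewrite !mxE rmorph_sum; apply: eq_bigr => k _.
by rewrite /= polyCM !mxE.
Qed.

Lemma formR_linear (R : comNzRingType) (d : 'I_n -> 'I_n -> 'I_n -> R) b u v :
  formR d (b *: u - v) = b *: formR d u - formR d v.
Proof.
apply/matrixP=> i j; rewrite !mxE mulr_sumr -sumrB.
by apply: eq_bigr => k _; rewrite !mxE mulrBl mulrA.
Qed.

Hypothesis Hc : jacobi c.
Variables (x a : 'rV[F]_n).
Local Notation A := (formR c x).
Local Notation B := (formR c a).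
Variables (Q : 'M[{poly F}]_n) (M : {poly F}).
Hypothesis M0 : M != 0.
Hypothesis QE : ('X *: lift B - lift A) *m Q = M *: lift B.

(** The form of [u] pulled back along [Q], a polynomial in the spectral parameter. *)
Definition pulled u (y z : 'cV[F]_n) : {poly F} :=
  ((lift y)^T *m (Q^T *m lift (formR c u) *m Q) *m lift z) 0 0.

Lemma pulledE u y z :
  pulled u y z = \sum_k (u 0 k)%:P * bracket cP (Q *m lift y) (Q *m lift z) 0 k.
Proof.
rewrite /pulled lift_formR !mulmxA -trmx_mul -mulmxA formR_bracket.
by apply: eq_bigr => k _; rewrite !mxE.
Qed.

(** Closedness of the inverse form. Since the pencil sends [Q p] to [M B p], each term times [M] is
    the form of ['X a - x] on a bracket of two vectors [Q y] and a third one; the Jacobi identity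
    over polynomials then applies, and [M] cancels. *)
Lemma pulled_cyclic (t y z : 'cV[F]_n) :
  pulled (B *m t)^T y z + pulled (B *m y)^T z t + pulled (B *m z)^T t y = 0.
Proof.
have E (p q r : 'cV[F]_n) : M * pulled (B *m p)^T q r =
    (bracket cP (Q *m lift q) (Q *m lift r) *m
      formR cP ('X *: lift a - lift x) *m (Q *m lift p)) 0 0.
  rewrite formR_linear -!lift_formR -[in RHS]mulmxA (mulmxA _ Q) QE -scalemxAl -scalemxAr.
  rewrite [RHS]mxE -map_mxM pulledE mxE; congr (_ * _); apply: eq_bigr => k _.
  rewrite mulrC; congr (_ * _); rewrite [RHS]mxE; congr (_%:P); exact: mxE.
apply: (mulfI M0); rewrite mulr0 !mulrDr !E.
have HcP : jacobi cP.
  move=> i j l m; rewrite /cP; under eq_bigr => k _ do rewrite -!polyCM -!polyCD.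
  by rewrite -rmorph_sum Hc.
exact: jacobi_form.
Qed.

Variables (l : F) (k : nat) (g : {poly F}).
Hypothesis ME : M = ('X - l%:P) ^+ k.+1 * g.
Hypothesis gl : g.[l] != 0.
Hypothesis As : A^T = - A.
Hypothesis Bs : B^T = - B.
Hypothesis variation : forall u, exists (M1 : {poly F}) (Q1 : 'M_n),
  - lift (formR c u) *m Q + ('X *: lift B - lift A) *m Q1 = M1 *: lift B
  /\ ('X - l%:P) ^+ k %| M1.

Definition lead (y z : 'cV[F]_n) : F := (((lift y)^T *m (lift B *m Q) *m lift z) 0 0).[l].

Let Xs : ('X *: lift B - lift A)^T = - ('X *: lift B - lift A).
Proof.
rewrite linearB linearZ /= !map_trmx As Bs opprB !map_mxN scalerN opprK.
by rewrite addrC.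
Qed.

Let Bls : (lift B)^T = - lift B.
Proof. by rewrite map_trmx Bs map_mxN. Qed.

Let scale00 (b : {poly F}) (Y : 'M[{poly F}]_1) : (b *: Y) 0 0 = b * Y 0 0.
Proof. by rewrite mxE. Qed.

Let sub00 (Y Z : 'M[{poly F}]_1) : (Y - Z) 0 0 = Y 0 0 - Z 0 0.
Proof. by rewrite !mxE. Qed.

(** The variation formula gives [Q^T A_u Q] as a combination of [M1 B Q] and [M B Q1]. At order [k]
    the second drops out, [M] having order at least [k + 1], and the first contributes a scalar
    independent of [y] and [z]. *)
Lemma pulled_lead u : exists d, forall y z, taylor_coef l k (pulled u y z) = d * lead y z.
Proof.
have [M1 [Q1 [E /dvdpP [b Eb]]]] := variation u.
have V := skew_resolvent_variation Xs Bls M0 QE E.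
exists (- b.[l]) => y z.
have -> : pulled u y z = ('X - l%:P) ^+ k *
   (- b * ((lift y)^T *m (lift B *m Q) *m lift z) 0 0
    + ('X - l%:P) * g * ((lift y)^T *m (lift B *m Q1) *m lift z) 0 0).
  rewrite /pulled; have -> : Q^T *m lift (formR c u) *m Q =
     - (M1 *: (lift B *m Q) - M *: (lift B *m Q1)).
    by rewrite -V mulmxN mulNmx opprK.
  rewrite opprB mulmxBr mulmxBl -!scalemxAr -!scalemxAl sub00 !scale00.
  rewrite Eb ME; move: (_ 0 0) (_ 0 0) => p q; rewrite exprSr; ring.
by rewrite taylor_coef_exp !hornerE subrr !mul0r addr0.
Qed.

(** Differentiation in the spectral parameter is the variation along [B] itself, with [M1] replaced
    by the derivative of [M], whose coefficient of order [k] at [l] is [(k + 1) g(l)]. *)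
Lemma pulled_base : exists h, forall y z, pulled a y z =
    ('X - l%:P) ^+ k * (g *+ k.+1 * ((lift y)^T *m (lift B *m Q) *m lift z) 0 0
       + ('X - l%:P) * h y z).
Proof.
have E : lift B *m Q + ('X *: lift B - lift A) *m map_mx (@deriv F) Q = M^`() *: lift B.
  have dB (P : {poly F}) (Y : 'M[F]_n) : map_mx (@deriv F) (P *: lift Y) = P^`() *: lift Y.
    by apply/matrixP=> i j; rewrite !mxE derivM derivC mulr0 addr0.
  have := congr1 (map_mx (@deriv F)) QE; rewrite deriv_mulmx dB => <-; congr (_ *m _ + _).
  apply/matrixP=> i j; rewrite !mxE derivB derivM derivX derivC mulr0 addr0 mul1r.
  by rewrite derivC subr0.
have V := skew_resolvent_variation Xs Bls M0 QE E.
exists (fun y z => g^`() * ((lift y)^T *m (lift B *m Q) *m lift z) 0 0 -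
  g * ((lift y)^T *m (lift B *m map_mx (@deriv F) Q) *m lift z) 0 0) => y z.
rewrite /pulled V mulmxBr mulmxBl -!scalemxAr -!scalemxAl sub00 !scale00.
rewrite ME derivM deriv_exp derivXsubC mul1r -/(k.+1).
move: (_ 0 0) (_ 0 0) => p q /=; rewrite exprSr.
have [kk nE] : exists kk : {poly F}, forall p, p *+ k.+1 = kk * p.
  by exists k.+1%:R => r; rewrite mulr_natl.
rewrite !nE; ring.
Qed.

(** The pairs [e0, f0] and [e1, f1] span two mutually orthogonal planes on which [lead] is
    nondegenerate, which makes its rank at least 4. The vector [m] represents the functional [mu]
    with [pulled u = mu(u) lead] at order [k]. *)
Lemma lead_functional e0 f0 e1 f1 :
  lead e0 f0 != 0 -> lead e1 f1 != 0 ->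
  lead f1 e0 = 0 -> lead e0 e1 = 0 -> lead f1 f0 = 0 -> lead f0 e1 = 0 ->
  exists m : 'cV[F]_n, [/\ B *m m = 0, (a *m m) 0 0 != 0 & ((x - l *: a) *m m) 0 0 = 0].
Proof.
move=> L0 L1 fe ee ff ef.
(* The coefficient of order [k] of the bracket of [Q e0] and [Q f0], normalised so that pairing [u]
   with [m] gives [mu(u)]. *)
pose m : 'cV[F]_n := \col_i
  (taylor_coef l k (bracket cP (Q *m lift e0) (Q *m lift f0) 0 i) / lead e0 f0).
have mE u : (u *m m) 0 0 = taylor_coef l k (pulled u e0 f0) / lead e0 f0.
  rewrite pulledE taylor_coef_sum mulr_suml mxE; apply: eq_bigr => i _.
  by rewrite taylor_coefZ mxE mulrA.
have muE u y z : taylor_coef l k (pulled u y z) = (u *m m) 0 0 * lead y z.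
  by have [d Hd] := pulled_lead u; rewrite mE !Hd mulfK.
pose th (t : 'cV[F]_n) := ((B *m t)^T *m m) 0 0.
have cyc t y z : th t * lead y z + th y * lead z t + th z * lead t y = 0.
  by rewrite -!muE -!taylor_coefD pulled_cyclic /taylor_coef comp_poly0 coef0.
(* In the cyclic identity for [e0, e1, f1] orthogonality leaves only [th e0 * lead e1 f1]. The same
   plane handles [f0], and the plane of [e0, f0] then handles every [t]. *)
have th_e0 : th e0 = 0.
  have := cyc e0 e1 f1; rewrite fe ee !mulr0 !addr0 => /eqP.
  by rewrite mulf_eq0 (negPf L1) orbF => /eqP.
have th_f0 : th f0 = 0.
  have := cyc f0 e1 f1; rewrite ff ef !mulr0 !addr0 => /eqP.
  by rewrite mulf_eq0 (negPf L1) orbF => /eqP.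
have th0 t : th t = 0.
  have := cyc t e0 f0; rewrite th_e0 th_f0 !mul0r !addr0 => /eqP.
  by rewrite mulf_eq0 (negPf L0) orbF => /eqP.
have [h Hh] := pulled_base.
exists m; split.
- apply/colP=> i; have := th0 (delta_mx i 0); rewrite /th trmx_mul Bs mulmxN mulNmx -mulmxA.
  rewrite trmx_delta -rowE mxE => /eqP; rewrite oppr_eq0 => /eqP Ei.
  by rewrite mxE in Ei; rewrite Ei mxE.
- rewrite mE Hh taylor_coef_exp !hornerE subrr mul0r addr0 hornerMn -/(lead e0 f0).
  by rewrite mulfK // -mulr_natr mulf_neq0.
- rewrite mE; apply/eqP; rewrite mulf_eq0; apply/orP; left.
  (* The form of [x - l a] is [('X - l) B] minus the pencil. The first gains one order over
     [pulled a], the second pulls back to [M Q^T B], so both have order at least [k + 1]. *)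
  have -> : pulled (x - l *: a) e0 f0 = ('X - l%:P) ^+ k.+1 *
     ((g *+ k.+1 * ((lift e0)^T *m (lift B *m Q) *m lift f0) 0 0
       + ('X - l%:P) * h e0 f0) - g * ((lift e0)^T *m (Q^T *m lift B) *m lift f0) 0 0).
    have -> : pulled (x - l *: a) e0 f0 = ('X - l%:P) * pulled a e0 f0
       - M * ((lift e0)^T *m (Q^T *m lift B) *m lift f0) 0 0.
      rewrite /pulled; have -> : lift (formR c (x - l *: a)) =
          ('X - l%:P) *: lift B - ('X *: lift B - lift A) :> 'M_n.
        have -> : formR c (x - l *: a) = A - l *: B.
          apply/matrixP=> i j; rewrite !mxE mulr_sumr -sumrB.
          by apply: eq_bigr => i' _; rewrite !mxE mulrBl mulrA.
        rewrite map_mxB map_mxZ /=; apply/matrixP=> i j; rewrite !mxE; ring.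
      rewrite mulmxBr mulmxBl -[Q^T *m ('X *: _ - _) *m Q]mulmxA QE.
      by rewrite mulmxBr mulmxBl -!scalemxAr -!scalemxAl -scalemxAr -scalemxAl sub00 !scale00.
    rewrite Hh ME; move: (_ *+ _) (_ 0 0) (_ 0 0) => b p q; rewrite exprSr; ring.
  by rewrite taylor_coef_expS.
Qed.

End LeadingCoefficient.

(** * Block normal forms *)

Lemma C_char0 k : k.+1%:R != 0 :> C.
Proof. by rewrite (@Num.Theory.pnatr_eq0 (Rdefinitions.R[i]) k.+1). Qed.

(* Keeps simplification from exposing the construction of the complex numbers. *)
Local Opaque C.

Definition bsizes (bl : seq jkblock) : nat := sumn (map bsize bl).

Lemma bsizes_cat bl1 bl2 : bsizes (bl1 ++ bl2) = (bsizes bl1 + bsizes bl2)%N.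
Proof. by rewrite /bsizes map_cat sumn_cat. Qed.

Section Bdiag.
Implicit Types (e : jkblock -> nat -> nat -> C) (bl : seq jkblock) (b : jkblock).

Lemma bdiag_at e bl1 b bl2 p q : (p < bsize b)%N -> (q < bsize b)%N ->
  bdiag e (bl1 ++ b :: bl2) (bsizes bl1 + p) (bsizes bl1 + q) = e b p q.
Proof.
move=> Hp Hq; elim: bl1 => [|b1 bl1 IH] /=; first by rewrite Hp Hq.
by rewrite -!addnA !ltnNge !leq_addr /= !addKn.
Qed.

Lemma bdiag_off e bl1 b bl2 p j : (p < bsize b)%N ->
  (j < bsizes bl1)%N || (bsizes bl1 + bsize b <= j)%N ->
  bdiag e (bl1 ++ b :: bl2) (bsizes bl1 + p) j = 0.
Proof.
move=> Hp; elim: bl1 j => [|b1 bl1 IH] j /=.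
  by rewrite !add0n => Hj; rewrite Hp ltnNge Hj /= (leqNgt _ p) Hp.
rewrite -!addnA (ltnNge _ (bsize b1)) leq_addr addKn /= => Hj.
case: leqP => // lj; apply: IH; move: Hj.
by rewrite -[in X in X -> _](subnKC lj) ltn_add2l leq_add2l.
Qed.

Lemma bdiag_skew e : (forall b p q, e b p q = - e b q p) ->
  forall bl i j, bdiag e bl i j = - bdiag e bl j i.
Proof.
move=> He; elim=> [|b bl IH] i j /=; first by rewrite oppr0.
rewrite andbC; case: ifP => _; first exact: He.
by rewrite andbC; case: ifP => _; rewrite ?oppr0.
Qed.

Lemma bdiag_linear e e1 e2 (t : C) :
  (forall b p q, e b p q = e1 b p q + t * e2 b p q) ->
  forall bl i j, bdiag e bl i j = bdiag e1 bl i j + t * bdiag e2 bl i j.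
Proof.
move=> He; elim=> [|b bl IH] i j /=; first by rewrite mulr0 addr0.
by case: ifP => _ //; case: ifP => _; rewrite ?mulr0 ?addr0.
Qed.

Lemma bdiag_eq (ok : pred jkblock) e1 e2 :
  (forall b p q, ok b -> (p < bsize b)%N -> (q < bsize b)%N -> e1 b p q = e2 b p q) ->
  forall bl, all ok bl -> forall i j, bdiag e1 bl i j = bdiag e2 bl i j.
Proof.
move=> He; elim=> [|b bl IH] //= /andP [okb /IH H] i j.
by case: ifP => [/andP [Hi Hj]|_]; rewrite ?He // H.
Qed.

Lemma bdiag_mul (ok : pred jkblock) e1 e2 e3 :
  (forall b p q, ok b -> (p < bsize b)%N -> (q < bsize b)%N ->
     \sum_(k < bsize b) e1 b p k * e2 b k q = e3 b p q) ->
  forall bl, all ok bl -> forall i j, (i < bsizes bl)%N -> (j < bsizes bl)%N ->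
  \sum_(k < bsizes bl) bdiag e1 bl i k * bdiag e2 bl k j = bdiag e3 bl i j.
Proof.
move=> He; elim=> [|b bl IH] //= /andP [okb okbl] i j Hi Hj.
rewrite -[bsizes (b :: bl)]/(bsize b + bsizes bl)%N in Hi Hj *.
rewrite big_split_ord /=.
under [X in X + _]eq_bigr => k _ do rewrite ltn_ord andbT (leqNgt _ k) ltn_ord /= andbF.
under [X in _ + X]eq_bigr => k _ do
  rewrite (ltnNge (_ + _)) leq_addr /= andbF addKn andbT.
have [Hib | Hib] := ltnP i (bsize b).
  rewrite /= [X in _ + X]big1 ?addr0; last by move=> k _; rewrite mul0r.
  have [Hjb | Hjb] := ltnP j (bsize b); first exact: He.
  by rewrite big1 // => k _; rewrite /= mulr0.
rewrite /= big1 ?add0r; last by move=> k _; rewrite mul0r.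
have [Hjb | Hjb] := ltnP j (bsize b).
  by rewrite big1 // => k _; rewrite /= mulr0.
apply: IH => //; by rewrite ltn_subLR // (leq_trans _ Hi, leq_trans _ Hj).
Qed.

Lemma bsizes_split bl i : (i < bsizes bl)%N ->
  exists bl1 b bl2 p, [/\ bl = bl1 ++ b :: bl2, (p < bsize b)%N & i = (bsizes bl1 + p)%N].
Proof.
elim: bl i => [|b bl IH] i //= Hi.
have [Hib | Hib] := ltnP i (bsize b); first by exists [::], b, bl, i.
have [|bl1 [b' [bl2 [p [-> Hp E]]]]] := IH (i - bsize b)%N; first by rewrite ltn_subLR.
exists (b :: bl1), b', bl2, p; split=> //.
by rewrite -[bsizes _]/(bsize b + bsizes bl1)%N -addnA -E subnKC.
Qed.

Lemma skewblk_skew h M p q : skewblk h M p q = - skewblk h M q p.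
Proof.
rewrite /skewblk !(ltnNge _ h); case: (leqP h p) => Hp; case: (leqP h q) => Hq //=.
- by rewrite oppr0.
- by rewrite opprK.
- by rewrite oppr0.
Qed.

Lemma NFA_skew n bl : (NFA n bl)^T = - NFA n bl.
Proof.
apply/matrixP=> i j; rewrite !mxE; apply: bdiag_skew => b p q.
by case: b => [k|[l|] m]; apply: skewblk_skew.
Qed.

Lemma NFB_skew n bl : (NFB n bl)^T = - NFB n bl.
Proof.
apply/matrixP=> i j; rewrite !mxE; apply: bdiag_skew => b p q.
by case: b => [k|[l|] m]; apply: skewblk_skew.
Qed.

End Bdiag.

(* With [f(J)] for [J] the upper Jordan block of eigenvalue [l]: entry (p, q) is
   the Taylor coefficient of [f] at [l] of order [q - p]. *)
Definition toeplitz (f : {poly C}) (p q : nat) : C := if (p <= q)%N then f`_(q - p) else 0.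

Definition shiftp (l : C) (f : {poly C}) : {poly C} := f \Po ('X + l%:P).

(** The form [B f(L)] on one block of the normal form, [L] being the operator of the pencil: [f = 1]
    gives [B] and [f = 'X] gives [A]. *)
Definition entryT (f : {poly C}) (b : jkblock) (p q : nat) : C :=
  if b is Jord (Some l) m then skewblk m (toeplitz (shiftp l f)) p q else 0.

(** Block diagonal with [f(J)] and its transpose, so that left multiplication turns the form of [g]
    into the form of [f * g]. *)
Definition entryG (f : {poly C}) (b : jkblock) (p q : nat) : C :=
  if b is Jord (Some l) m then
    if (p < m)%N && (q < m)%N then toeplitz (shiftp l f) p q
    else if (m <= p)%N && (m <= q)%N then toeplitz (shiftp l f) (q - m) (p - m) else 0
  else 0.

Definition finite_block (b : jkblock) : bool :=
  match b with Kron k => k == 1%N | Jord (Some _) _ => true | _ => false end.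

(** Entry [(i, k)] is the coefficient of ['X^k] in [f * 'X^i], so the matrix product is a
    convolution; as [j < m], the truncation at [m] loses nothing. *)
Lemma toeplitz_mul f g m i j : (j < m)%N ->
  \sum_(k < m) toeplitz f i k * toeplitz g k j = toeplitz (f * g) i j.
Proof.
move=> Hj; have E p k : toeplitz p i k = (p * 'X^i)`_k.
  by rewrite coefMXn /toeplitz ltnNge; case: leqP.
rewrite E mulrAC coefM (bigID (fun k : 'I_m => (k <= j)%N)) /= [X in _ + X]big1 ?addr0.
  rewrite (big_ord_widen_cond m xpredT (fun k => (f * 'X^i)`_k * g`_(j - k))) //.
  by apply: eq_big => k; rewrite ?ltnS //= => Hk; rewrite E /toeplitz Hk.
by move=> k /negPf Hk; rewrite /toeplitz Hk mulr0.
Qed.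

Lemma entryG_entryT f g b p q : (p < bsize b)%N -> (q < bsize b)%N ->
  \sum_(k < bsize b) entryG f b p k * entryT g b k q = entryT (f * g) b p q.
Proof.
case: b => [k|[l|] m] /= Hp Hq; try by rewrite big1 // => ? _; rewrite mul0r.
rewrite /shiftp rmorphM /= -/(shiftp l f) -/(shiftp l g).
rewrite mul2n -addnn in Hp Hq *; rewrite big_split_ord /= /skewblk.
under [X in X + _]eq_bigr => k _ do
  rewrite ltn_ord (leqNgt _ k) ltn_ord /= ?andbT ?andbF.
under [X in _ + X]eq_bigr => k _ do
  rewrite (ltnNge (_ + _)) leq_addr addKn /= ?andbF ?andbT.
have [pm | pm] := ltnP p m => /=.
  rewrite [X in _ + X]big1 ?addr0; last by move=> k _; rewrite mul0r.
  have [qm | qm] := leqP m q; first by rewrite toeplitz_mul // ltn_subLR.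
  by rewrite big1 // => k _; rewrite mulr0.
rewrite [X in X + _]big1 ?add0r; last by move=> k _; rewrite mul0r.
have [qm | qm] := ltnP q m; last by rewrite big1 // => k _; rewrite mulr0.
under eq_bigr => k _ do rewrite mulrN mulrC.
by rewrite sumrN toeplitz_mul ?ltn_subLR // mulrC.
Qed.

Definition NFT n (f : {poly C}) bl : 'M[C]_n := \matrix_(i, j) bdiag (entryT f) bl i j.

Lemma NFT_linear n t f g bl : NFT n (f + t *: g) bl = NFT n f bl + t *: NFT n g bl.
Proof.
apply/matrixP=> i j; rewrite !mxE; apply: bdiag_linear => b p q.
case: b => [k|[l|] m] /=; rewrite ?mulr0 ?addr0 // /skewblk /toeplitz /shiftp.
rewrite comp_polyD comp_polyZ !coefD !coefZ.
by do !case: ifP => _; rewrite ?(oppr0, mulr0, addr0) // opprD mulrN.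
Qed.

Lemma NFT_sum n D (t : 'I_D -> C) (f : 'I_D -> {poly C}) bl :
  NFT n (\sum_(k < D) t k *: f k) bl = \sum_(k < D) t k *: NFT n (f k) bl.
Proof.
have NFT0 : NFT n 0 bl = 0.
  have := NFT_linear n (-1) 0 0 bl; rewrite scaleN1r subrr => ->.
  by rewrite scaleN1r subrr.
elim/big_rec2: _ => // k f' h _ E; by rewrite addrC NFT_linear E addrC.
Qed.

Lemma kd_toeplitz p q : kd p q = toeplitz 1 p q.
Proof. by rewrite /kd /toeplitz coef1 subn_eq0 eqn_leq; case: leqP. Qed.

Lemma jordJ_toeplitz l p q : jordJ l p q = toeplitz ('X + l%:P) p q.
Proof.
rewrite /jordJ /toeplitz coefD coefX coefC; case: (ltngtP p q) => [lt_pq||->].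
- rewrite subn_eq0 leqNgt lt_pq addr0 /= -{1}(subnKC (ltnW lt_pq)) -addn1 eqn_add2l.
  by case: eqP.
- by move=> lt_qp; case: eqP => // E; rewrite E ltnNge leqnSn in lt_qp.
- by rewrite subnn add0r.
Qed.

Lemma NFB_NFT n bl : all finite_block bl -> NFB n bl = NFT n 1 bl.
Proof.
move=> ok; apply/matrixP=> i j; rewrite !mxE; apply: bdiag_eq ok _ _ => b p q.
case: b => [k|[l|] m] //=.
  by move=> /eqP -> /=; rewrite !ltnS !leqn0 => /eqP -> /eqP ->.
by move=> _ _ _; rewrite /skewblk !kd_toeplitz /shiftp rmorph1.
Qed.

Lemma NFA_NFT n bl : all finite_block bl -> NFA n bl = NFT n 'X bl.
Proof.
move=> ok; apply/matrixP=> i j; rewrite !mxE; apply: bdiag_eq ok _ _ => b p q.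
case: b => [k|[l|] m] //=.
  by move=> /eqP -> /=; rewrite !ltnS !leqn0 => /eqP -> /eqP ->.
by move=> _ _ _; rewrite /skewblk !jordJ_toeplitz /shiftp comp_polyX.
Qed.

Lemma JKdecomp_skew n (A B : 'M[C]_n) bl : JKdecomp A B bl -> A^T = - A /\ B^T = - B.
Proof.
case=> _ _ [P Pu [EA EB]].
have H (X N : 'M[C]_n) : P^T *m X *m P = N -> N^T = - N -> X^T = - X.
  move=> E Ns; have Pu' : P^T \in unitmx by rewrite unitmx_tr.
  apply: (can_inj (mulKmx Pu')); apply: (can_inj (mulmxK Pu)).
  rewrite mulmxN mulNmx E -Ns -E !trmx_mul trmxK mulmxA.
  by [].
by split; [apply: H EA (NFA_skew n bl) | apply: H EB (NFB_skew n bl)].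
Qed.

(** * Polynomials in the pencil operator, in normal form *)

Section Decomposition.
Variables (n : nat) (A B S P : 'M[C]_n) (bl : seq jkblock).
Hypothesis bln : bsizes bl = n.
Hypothesis okbl : all finite_block bl.
Hypothesis Pu : P \in unitmx.
Hypothesis EA : P^T *m A *m P = NFA n bl.
Hypothesis EB : P^T *m B *m P = NFB n bl.
Hypothesis BSA : B *m S *m A = A.
Local Notation L := (S *m A).

Definition NFG f : 'M[C]_n := \matrix_(i, j) bdiag (entryG f) bl i j.

Lemma NFG_NFT f g : NFG f *m NFT n g bl = NFT n (f * g) bl.
Proof.
apply/matrixP=> i j; rewrite !mxE.
under eq_bigr => k _ do rewrite !mxE.
have Hi := ltn_ord i; have Hj := ltn_ord j.
move: (nat_of_ord i) (nat_of_ord j) Hi Hj => p q; rewrite -bln => Hp Hq.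
by apply: bdiag_mul Hp Hq; [move=> b *; apply: entryG_entryT | exact: okbl].
Qed.

(** Rewriting [B L ^+ k] as an operator on the left of [P^T B] lets the next factor [S A] meet [B],
    where [BSA] turns it into [A]; the matrix of [S] is never computed. *)
Lemma congr_mxpow k : P^T *m (B *m mxpow L k) *m P = NFT n 'X^k bl.
Proof.
elim: k => [|k IHk]; first by rewrite /mxpow /= mulmx1 EB NFB_NFT.
have E : P^T *m (B *m mxpow L k) = NFG 'X^k *m (P^T *m B).
  apply: (can_inj (mulmxK Pu)).
  by rewrite IHk -[RHS]mulmxA EB NFB_NFT // NFG_NFT mulr1.
rewrite mxpowSr !mulmxA -[P^T *m B *m _]mulmxA E -!mulmxA (mulmxA B) (mulmxA (B *m S)) BSA.
by rewrite (mulmxA P^T) EA NFA_NFT // NFG_NFT -exprSr.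
Qed.

Lemma congr_poly D (f : nat -> C) :
  P^T *m (\sum_(k < D) f k *: (B *m mxpow L k)) *m P =
  NFT n (\sum_(k < D) f k *: 'X^k) bl.
Proof.
rewrite NFT_sum mulmx_sumr mulmx_suml; apply: eq_bigr => k _.
by rewrite -scalemxAr -scalemxAl congr_mxpow.
Qed.

(** [dd k] is the scalar quotient [('X^k - l^k) / ('X - l)], and divided differences of [L]
    correspond to it. The polynomial with coefficients [f] vanishes at [l], so the constants [l^k]
    cancel in the sum. *)
Lemma congr_divdiff l D (f : nat -> C) h :
  \sum_(k < D) f k *: 'X^k = ('X - l%:P) * h ->
  P^T *m (B *m resolvent l L D f) *m P = NFT n h bl.
Proof.
pose fix dd k : {poly C} := if k is k'.+1 then 'X^k' + l *: dd k' else 0.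
have Edd k : ('X - l%:P) * dd k = 'X^k - (l ^+ k)%:P.
  elim: k => [|k IHk] /=; first by rewrite mulr0 expr0 subrr.
  rewrite mulrDr -scalerAr IHk -mul_polyC mulrBr mulrBl -exprS -polyCM -exprS; ring.
have E k : P^T *m (B *m divdiff l L k) *m P = NFT n (dd k) bl.
  elim: k => [|k IHk] /=.
    by rewrite !mulmx0 mul0mx; have := NFT_sum n (fun=> 0) (fun=> 0) bl (D := 0); rewrite !big_ord0.
  by rewrite NFT_linear mulmxDr mulmxDr mulmxDl congr_mxpow -!scalemxAr -scalemxAl IHk.
move=> Eh.
have -> : h = \sum_(k < D) f k *: dd k.
  apply: (@mulfI _ ('X - l%:P)); first by rewrite polyXsubC_eq0.
  rewrite -Eh mulr_sumr.
  have E0 : \sum_(k < D) f k * l ^+ k = 0.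
    have := congr1 (fun p => p.[l]) Eh; rewrite hornerM hornerXsubC subrr mul0r horner_sum.
    by move=> E0; rewrite -[RHS]E0; apply: eq_bigr => k _; rewrite hornerZ hornerXn.
  under [RHS]eq_bigr => k _ do rewrite -scalerAr Edd scalerBr -[_ *: _%:P]mul_polyC -polyCM.
  by rewrite sumrB -rmorph_sum E0 subr0.
rewrite NFT_sum /resolvent !mulmx_sumr mulmx_suml; apply: eq_bigr => k _.
by rewrite -!scalemxAr -scalemxAl E.
Qed.

Definition dvd_block f b :=
  if b is Jord (Some l) m then ('X - l%:P) ^+ m %| f else true.

Lemma dvdp_shift l m (f : {poly C}) :
  reflect (forall q, (q < m)%N -> (shiftp l f)`_q = 0) (('X - l%:P) ^+ m %| f).
Proof.
apply: (iffP (dvdpP _ _)) => [[h ->] q Hq|H].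
  rewrite /shiftp rmorphM rmorphXn /= comp_polyB comp_polyX comp_polyC addrK.
  by rewrite coefMXn Hq.
have E : f = shiftp l f \Po ('X - l%:P).
  by rewrite /shiftp -comp_polyA comp_polyD comp_polyX comp_polyC subrK comp_polyXr.
exists (drop_poly m (shiftp l f) \Po ('X - l%:P)).
rewrite {1}E -{1}(poly_take_drop m (shiftp l f)).
have -> : take_poly m (shiftp l f) = 0.
  by apply/polyP=> q; rewrite coef_take_poly coef0; case: ifP => // /H.
by rewrite add0r rmorphM rmorphXn /= comp_polyX.
Qed.

Lemma all_splitP (T : Type) (ok : pred T) s :
  (forall s1 y s2, s = s1 ++ y :: s2 -> ok y) -> all ok s.
Proof.
elim: s => //= y s IH H; rewrite (H [::] y s) //= IH // => s1 z s2 E.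
by apply: (H (y :: s1) z s2); rewrite E.
Qed.

Lemma block_pos bl1 b bl2 p : bl = bl1 ++ b :: bl2 -> (p < bsize b)%N ->
  (bsizes bl1 + p < n)%N.
Proof.
move=> E Hp; rewrite -bln E bsizes_cat ltn_add2l.
by apply: leq_trans Hp _; apply: leq_addr.
Qed.

Lemma NFT_eq0 f : (NFT n f bl == 0) = all (dvd_block f) bl.
Proof.
apply/eqP/idP => [E0|H].
  apply: all_splitP => bl1 b bl2 E; case: b E => [//|[l|//] m] E /=.
  apply/dvdp_shift => q Hq.
  have H0 : (0 < bsize (Jord (Some l) m))%N.
    by rewrite /= (leq_trans _ (leq_pmull _ _)) // (leq_ltn_trans _ Hq).
  have Hm : (m + q < bsize (Jord (Some l) m))%N by rewrite /= mul2n -addnn ltn_add2l.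
  (* The first row of a block lists all Taylor coefficients of [f] at [l] of order below [m]. *)
  have /matrixP /(_ (Ordinal (block_pos E H0)) (Ordinal (block_pos E Hm))) := E0.
  rewrite !mxE E bdiag_at //= /skewblk (leq_ltn_trans _ Hq) // leq_addr /=.
  by rewrite addKn /toeplitz subn0.
apply/matrixP=> i j; rewrite !mxE.
rewrite (@bdiag_eq (dvd_block f) _ (fun _ _ _ => 0)) //.
  by elim: bl (nat_of_ord i) (nat_of_ord j) => //= b bl' IH p q; rewrite IH; do !case: ifP.
case=> [//|[l|//] m] p q /= /dvdp_shift Hf; rewrite mul2n -addnn => Hp Hq.
have T0 p' q' : (q' < m)%N -> toeplitz (shiftp l f) p' q' = 0.
  by move=> Hq'; rewrite /toeplitz; case: ifP => // _; rewrite Hf // (leq_ltn_trans (leq_subr _ _)).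
rewrite /skewblk; case: ifP => [/andP [_ Hmq]|_]; first by rewrite T0 // ltn_subLR.
by case: ifP => // /andP [Hmp _]; rewrite T0 ?oppr0 // ltn_subLR.
Qed.

Lemma relation_dvd D (f : nat -> C) :
  (\sum_(k < D) f k *: (B *m mxpow L k) == 0) =
  all (dvd_block (\sum_(k < D) f k *: 'X^k)) bl.
Proof.
rewrite -NFT_eq0 -congr_poly; apply/eqP/eqP => [->|E].
  by rewrite mulmx0 mul0mx.
have Pu' : P^T \in unitmx by rewrite unitmx_tr.
apply: (can_inj (mulKmx Pu')); apply: (can_inj (mulmxK Pu)).
by rewrite E mulmx0 mul0mx.
Qed.

End Decomposition.

(** * Corank of the pencil *)

Lemma bdiag_row0 e bl1 b bl2 p j : (p < bsize b)%N ->
  (forall q, (q < bsize b)%N -> e b p q = 0) ->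
  bdiag e (bl1 ++ b :: bl2) (bsizes bl1 + p) j = 0.
Proof.
move=> Hp He; have [lt_j | le_j] := ltnP j (bsizes bl1).
  by rewrite bdiag_off ?lt_j.
have [le_j' | lt_j] := leqP (bsizes bl1 + bsize b) j.
  by rewrite bdiag_off ?le_j' ?orbT.
by rewrite -(subnKC le_j) bdiag_at ?He // ltn_subLR.
Qed.

Lemma kron_split bl : kron_sizes bl = [:: 1%N] ->
  exists bl1 bl2, [/\ bl = bl1 ++ Kron 1 :: bl2, kron_sizes bl1 = [::]
                    & kron_sizes bl2 = [::]].
Proof.
elim: bl => [|[k|l m] bl IH] //=; rewrite /kron_sizes /= -/(kron_sizes bl).
  by case=> -> E; exists [::], bl.
by move/IH => [bl1 [bl2 [-> E1 E2]]]; exists (Jord l m :: bl1), bl2.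
Qed.

Definition corank_le1 n (B : 'M[C]_n) :=
  exists z : 'rV[C]_n, forall w : 'rV_n, w *m B = 0 -> exists t, w = t *: z.

Lemma congr_row0 n (A P N : 'M[C]_n) i : P \in unitmx -> P^T *m A *m P = N ->
  (forall j, N i j = 0) -> (delta_mx 0 i : 'rV_n) *m P^T *m A = 0.
Proof.
move=> Pu E N0; apply: (can_inj (mulmxK Pu)); rewrite mul0mx -!mulmxA (mulmxA P^T) E.
by rewrite -rowE; apply/rowP=> j; rewrite !mxE N0.
Qed.

Lemma common_kernel n (A B : 'M[C]_n) bl : JKdecomp A B bl -> kron_sizes bl = [:: 1%N] ->
  exists w : 'rV[C]_n, [/\ w != 0, w *m A = 0 & w *m B = 0].
Proof.
case=> _ bln [P Pu [EA EB]] /kron_split [bl1 [bl2 [E _ _]]].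
have Hi : (bsizes bl1 + 0 < n)%N by rewrite -bln; apply: (block_pos (erefl _) E).
exists (delta_mx 0 (Ordinal Hi) *m P^T); split.
- apply/eqP=> E0.
  have := congr1 (fun X => X *m invmx P^T) E0.
  rewrite mulmxK ?unitmx_tr // mul0mx => /matrixP /(_ 0 (Ordinal Hi)).
  by rewrite !mxE !eqxx => /eqP; rewrite oner_eq0.
- apply: (congr_row0 Pu EA) => j; rewrite mxE E; apply: bdiag_row0 => // q.
  by rewrite /= ltnS leqn0 => /eqP ->.
- apply: (congr_row0 Pu EB) => j; rewrite mxE E; apply: bdiag_row0 => // q.
  by rewrite /= ltnS leqn0 => /eqP ->.
Qed.

(** A Jordan block at infinity would make [B] degenerate on it, giving a kernel vector independent
    of the one of the Kronecker block. *)
Lemma corank_le1_finite n (A B : 'M[C]_n) bl : JKdecomp A B bl ->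
  kron_sizes bl = [:: 1%N] -> corank_le1 B -> all finite_block bl.
Proof.
case=> vbl bln [P Pu [EA EB]] Ek [z Hz].
apply: all_splitP => bl1 b bl2 E; case: b E => [k|[l|] m] E //=.
  by move: Ek; rewrite E /kron_sizes pmap_cat /=; case: (pmap _ _) => [[->]|? []].
have [bl1' [bl2' [E' _ _]]] := kron_split Ek.
have m0 : (0 < m)%N by move: vbl; rewrite E all_cat /= => /and3P [].
(* Row [m.-1], the last of the upper half, is zero in [B]: the superdiagonal 1 would fall outside
   the block. *)
have Hm : (m.-1 < bsize (Jord None m))%N by rewrite /= mul2n -addnn prednK // leq_addr.
have Hp := block_pos bln E Hm.
have Hi : (bsizes bl1' + 0 < n)%N by apply: (block_pos bln E').
have neq_pi : Ordinal Hp != Ordinal Hi.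
  apply/eqP=> [[/esym Epi]].
  (* Marks Kronecker blocks by 1 and Jordan blocks by 0, which separates the two positions. *)
  pose e0 (b : jkblock) (p q : nat) : C := if b is Kron _ then 1 else 0.
  have := bdiag_at e0 bl1' bl2' (p := 0) (q := 0) (b := Kron 1) isT isT.
  rewrite Epi -E' E bdiag_at // => /eqP.
  by rewrite eq_sym oner_eq0.
have [|t Et] := Hz (delta_mx 0 (Ordinal Hp) *m P^T).
  apply: (congr_row0 Pu EB) => j; rewrite mxE E; apply: bdiag_row0 => // q Hq /=.
  rewrite /skewblk (leqNgt m m.-1) ltn_predL m0 /= /jordJ prednK //.
  case: ifP => // Hmq; case: ifP => // _; rewrite ltn_eqF //.
  by rewrite ltn_subLR // addnn -mul2n.
have [|t' Et'] := Hz (delta_mx 0 (Ordinal Hi) *m P^T).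
  apply: (congr_row0 Pu EB) => j; rewrite mxE E'; apply: bdiag_row0 => // q.
  by rewrite /= ltnS leqn0 => /eqP ->.
have Pu' : P^T \in unitmx by rewrite unitmx_tr.
have : t' *: (delta_mx 0 (Ordinal Hp) : 'rV_n) = t *: delta_mx 0 (Ordinal Hi).
  apply: (can_inj (mulmxK Pu')).
  by rewrite -!scalemxAl Et Et' !scalerA mulrC.
move/matrixP => H.
have := H 0 (Ordinal Hi); rewrite !mxE !eqxx [_ == Ordinal Hp]eq_sym (negPf neq_pi) mulr0 mulr1.
move=> t0; move/(congr1 (mulmx^~ (invmx P^T))): Et.
rewrite mulmxK // -t0 scale0r mul0mx => /matrixP /(_ 0 (Ordinal Hp)).
by rewrite !mxE !eqxx => /eqP; rewrite oner_eq0.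
Qed.

(** Triangular elimination: the last [m] columns kill the first half of [v] in increasing order, the
    first [m] columns kill the second half in decreasing order. *)
Lemma skewblk_kernel m (M : nat -> nat -> C) (v : nat -> C) :
  (forall p q, (q < p)%N -> M p q = 0) -> (forall p, M p p != 0) ->
  (forall j, (j < m + m)%N -> \sum_(p < m + m) v p * skewblk m M p j = 0) ->
  forall p, (p < m + m)%N -> v p = 0.
Proof.
move=> Mu Md Hv.
have Hlow q : (q < m)%N -> v q = 0.
  elim/ltn_ind: q => q IH Hq.
  have := Hv (m + q)%N; rewrite ltn_add2l => /(_ Hq).
  rewrite big_split_ord /= [X in _ + X]big1 => [|p _]; last first.
    by rewrite /skewblk !(ltnNge (_ + _)) !leq_addr /= mulr0.
  rewrite addr0 (bigD1 (Ordinal Hq)) //= big1 => [|p Hp].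
    rewrite addr0 /skewblk Hq leq_addr /= addKn => /eqP.
    by rewrite mulf_eq0 (negPf (Md q)) orbF => /eqP.
  rewrite /skewblk ltn_ord leq_addr /= addKn; have [lt_pq | lt_qp | E] := ltngtP p q.
  - by rewrite IH ?mul0r.
  - by rewrite Mu ?mulr0.
  - by case/eqP: Hp; apply: val_inj.
have Hhigh r q : (q < m)%N -> (m - q <= r)%N -> v (m + q)%N = 0.
  elim: r q => [|r IH] q Hq; first by rewrite leqn0 subn_eq0 leqNgt Hq.
  move=> Hr; have := Hv q; rewrite (leq_trans Hq) ?leq_addr // => /(_ isT).
  rewrite big_split_ord /= big1 => [|p _]; last first.
    by rewrite /skewblk (leqNgt m q) Hq /= (leqNgt m p) ltn_ord /= mulr0.
  rewrite add0r (bigD1 (Ordinal Hq)) //= big1 => [|p Hp].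
    rewrite addr0 /skewblk (ltnNge (_ + _)) leq_addr Hq /= addKn => /eqP.
    by rewrite mulrN oppr_eq0 mulf_eq0 (negPf (Md q)) orbF => /eqP.
  rewrite /skewblk (ltnNge (_ + _)) leq_addr Hq /= addKn.
  have [lt_pq | lt_qp | E] := ltngtP p q.
  - by rewrite Mu ?oppr0 ?mulr0.
  - rewrite IH ?mul0r //; rewrite -ltnS; apply: leq_trans Hr; apply: ltn_sub2l => //.
  - by case/eqP: Hp; apply: val_inj.
move=> p Hp; have [Hpm | Hpm] := ltnP p m; first exact: Hlow.
by rewrite -(subnKC Hpm); apply: (Hhigh m); rewrite ?leq_subr // ltn_subLR.
Qed.

Lemma bdiag_col_sum e bl1 b bl2 (v : nat -> C) j :
  (forall b p q, e b p q = - e b q p) -> (j < bsize b)%N ->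
  \sum_(i < bsizes (bl1 ++ b :: bl2)) v i * bdiag e (bl1 ++ b :: bl2) i (bsizes bl1 + j)
  = \sum_(p < bsize b) v (bsizes bl1 + p)%N * e b p j.
Proof.
move=> He Hj; rewrite bsizes_cat -[bsizes (b :: bl2)]/(bsize b + bsizes bl2)%N.
rewrite big_split_ord /= big1 ?add0r => [|i _]; last first.
  by rewrite bdiag_skew // bdiag_off ?ltn_ord // oppr0 mulr0.
rewrite big_split_ord /= [X in _ + X]big1 ?addr0 => [|i _]; last first.
  by rewrite bdiag_skew // bdiag_off ?addnA ?leq_addr ?orbT // oppr0 mulr0.
by apply: eq_bigr => p _; rewrite bdiag_at.
Qed.

(** [1 + t * l] is the diagonal entry of [B + t A] on a block at [l]; at infinity that entry is
    [t]. *)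
Definition regular_at (t : C) (b : jkblock) : bool :=
  if b is Jord (Some l) _ then 1 + t * l != 0 else true.

Lemma entryA_skew b p q : entryA b p q = - entryA b q p.
Proof. by case: b => [k|[l|] m]; apply: skewblk_skew. Qed.

Lemma entryB_skew b p q : entryB b p q = - entryB b q p.
Proof. by case: b => [k|[l|] m]; apply: skewblk_skew. Qed.

Lemma skewblk_linear h (M N : nat -> nat -> C) t p q :
  skewblk h M p q + t * skewblk h N p q = skewblk h (fun p q => M p q + t * N p q) p q.
Proof.
by rewrite /skewblk; do 2?case: ifP => _; rewrite ?mulr0 ?addr0 // opprD mulrN.
Qed.

Lemma jord_kernel l m (t : C) (v : nat -> C) : t != 0 -> regular_at t (Jord l m) ->
  let e b p q := entryB b p q + t * entryA b p q in
  (forall j, (j < bsize (Jord l m))%N ->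
     \sum_(p < bsize (Jord l m)) v p * e (Jord l m) p j = 0) ->
  forall p, (p < bsize (Jord l m))%N -> v p = 0.
Proof.
move=> t0; rewrite /= mul2n -addnn; case: l => [l|] /= Hl Hv.
- apply: (@skewblk_kernel m (fun p q => kd p q + t * jordJ l p q)).
  + by move=> p q lt_qp; rewrite kd_toeplitz jordJ_toeplitz /toeplitz leqNgt lt_qp mulr0 addr0.
  + by move=> p; rewrite /kd /jordJ eqxx mulr1n.
  + by move=> j /Hv E; rewrite -[RHS]E; apply: eq_bigr => p _; rewrite skewblk_linear.
- apply: (@skewblk_kernel m (fun p q => jordJ 0 p q + t * kd p q)).
  + by move=> p q lt_qp; rewrite kd_toeplitz jordJ_toeplitz /toeplitz leqNgt lt_qp mulr0 addr0.
  + by move=> p; rewrite /kd /jordJ eqxx mulr1n mulr1 add0r.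
  + by move=> j /Hv E; rewrite -[RHS]E; apply: eq_bigr => p _; rewrite skewblk_linear.
Qed.

(** Regularity makes [B + t A] nondegenerate on each Jordan block, so kernel vectors live on the
    single Kronecker coordinate. *)
Lemma pencil_corank n (A B : 'M[C]_n) bl t : JKdecomp A B bl ->
  kron_sizes bl = [:: 1%N] -> t != 0 -> all (regular_at t) bl ->
  corank_le1 (B + t *: A).
Proof.
case=> _ bln [P Pu [EA EB]] Ek t0 reg.
have {}bln : bsizes bl = n := bln.
have [bl1 [bl2 [E k1 k2]]] := kron_split Ek.
have Hi : (bsizes bl1 + 0 < n)%N by apply: (block_pos bln E).
exists (delta_mx 0 (Ordinal Hi) *m P^T) => w Hw.
have Pu' : P^T \in unitmx by rewrite unitmx_tr.
pose u := w *m invmx P^T; exists (u 0 (Ordinal Hi)).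
have Ew : u *m P^T = w by rewrite mulmxKV.
have uN : u *m (NFB n bl + t *: NFA n bl) = 0.
  by rewrite -EA -EB scalemxAl scalemxAr -mulmxDl -mulmxDr !mulmxA Ew Hw mul0mx.
(* Coordinates extended by 0 to all natural numbers, so that positions can be written as block
   offset plus index. *)
clearbody u; pose v i := oapp (u 0) 0 (insub i).
have vE (i : 'I_n) : v i = u 0 i by rewrite /v valK.
pose e b p q := entryB b p q + t * entryA b p q.
have He b p q : e b p q = - e b q p.
  by rewrite /e entryA_skew entryB_skew opprD mulrN.
have v0 s1 b s2 p : bl = s1 ++ b :: s2 -> kron_of b = None -> (p < bsize b)%N ->
    v (bsizes s1 + p)%N = 0.
  case: b => [//|l m] Es _.
  apply: (@jord_kernel l m t (fun p => v (bsizes s1 + p)%N) t0).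
    by move: reg; rewrite Es all_cat /= => /and3P [].
  move=> j Hj; have Hq := block_pos bln Es Hj.
  rewrite -(bdiag_col_sum s1 s2 v He Hj) -Es bln.
  have /matrixP /(_ 0 (Ordinal Hq)) := uN; rewrite !mxE => E0; rewrite -[RHS]E0.
  apply: eq_bigr => i _; rewrite vE !mxE.
  by congr (_ * _); apply: bdiag_linear.
have nokron s b s' : kron_sizes (s ++ b :: s') = [::] -> kron_of b = None.
  by rewrite /kron_sizes pmap_cat /=; case: (pmap _ s) => //; case: (kron_of b).
rewrite -[LHS]Ew scalemxAl; congr (_ *m _); apply/rowP=> i; rewrite !mxE eqxx /=.
have [-> | neq_i] := eqVneq i (Ordinal Hi); first by rewrite mulr1.
rewrite mulr0 -vE; have [lt_i | le_i] := ltnP i (bsizes bl1).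
  have [s1 [b [s2 [p [Es Hp ->]]]]] := bsizes_split lt_i.
  apply: (v0 s1 b (s2 ++ Kron 1 :: bl2)) => //; first by rewrite E Es -catA.
  by apply: (nokron s1 b s2); rewrite -Es.
have lt_i : (i - (bsizes bl1 + 1) < bsizes bl2)%N.
  have := ltn_ord i; rewrite -{2}bln E bsizes_cat -[bsizes (_ :: _)]/(1 + bsizes bl2)%N.
  rewrite ltn_subLR ?addnA //; rewrite addn1 ltn_neqAle le_i andbT.
  by apply: contra neq_i => /eqP Ei; apply/eqP/val_inj; rewrite /= addn0.
have [s1 [b [s2 [p [Es Hp Ei]]]]] := bsizes_split lt_i.
have -> : nat_of_ord i = (bsizes (bl1 ++ Kron 1 :: s1) + p)%N.
  rewrite bsizes_cat -[bsizes (_ :: _)]/(1 + bsizes s1)%N addnA -addnA -Ei subnKC //.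
  rewrite addn1 ltn_neqAle le_i andbT.
  by apply: contra neq_i => /eqP Ej; apply/eqP/val_inj; rewrite /= addn0.
apply: (v0 _ b s2) => //; first by rewrite E Es -catA.
by apply: (nokron s1 b s2); rewrite -Es.
Qed.

(** * Minimal polynomial of a Jordan-Kronecker form *)

Definition size_at (o : option C) (b : jkblock) : option nat :=
  if b is Jord o' m then (if o' == o then Some m else None) else None.

Lemma jtupleE bl o : jtuple bl o = sort geq (pmap (size_at o) bl).
Proof. by []. Qed.

(** The default 0 is reached only at infinity, which [finite_block] excludes. *)
Definition mroots (bl : seq jkblock) : seq C := map (odflt 0) (eigs bl).
Definition mexp (bl : seq jkblock) (l : C) : nat := head 0%N (jtuple bl (Some l)).
Definition minpol (bl : seq jkblock) : {poly C} :=
  \prod_(l <- mroots bl) ('X - l%:P) ^+ mexp bl l.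

Lemma mem_pmap_split (T : Type) (U : eqType) (f : T -> option U) s y :
  y \in pmap f s -> exists s1 b s2, s = s1 ++ b :: s2 /\ f b = Some y.
Proof.
elim: s => //= b s IH; case E: (f b) => [z|] /=; last first.
  by move/IH => [s1 [b' [s2 [-> Eb]]]]; exists (b :: s1), b', s2.
rewrite inE => /orP [/eqP ->|/IH [s1 [b' [s2 [-> Eb]]]]]; first by exists [::], b, s.
by exists (b :: s1), b', s2.
Qed.

Lemma pmap_split_mem (T : Type) (U : eqType) (f : T -> option U) s1 b s2 y :
  f b = Some y -> y \in pmap f (s1 ++ b :: s2).
Proof. by move=> E; rewrite pmap_cat /= E /= mem_cat mem_head orbT. Qed.

Lemma mem_jtuple bl o m : (m \in jtuple bl o) = (m \in pmap (size_at o) bl).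
Proof. by rewrite jtupleE mem_sort. Qed.

Lemma jtuple_max bl o m : m \in jtuple bl o -> (m <= head 0 (jtuple bl o))%N.
Proof.
have : sorted geq (jtuple bl o).
  by rewrite jtupleE sort_sorted // => x y; apply: leq_total.
case: (jtuple bl o) => //= h t Hp; rewrite inE => /orP [/eqP -> //|Ht].
have /allP := order_path_min (fun y x z H1 H2 => leq_trans H2 H1) Hp.
by apply.
Qed.

Lemma size_at_Some o b m : size_at o b = Some m -> b = Jord o m.
Proof. by case: b => //= o' m'; case: eqP => // -> [->]. Qed.

Lemma eigs_finite bl : all finite_block bl -> eigs bl = map Some (mroots bl).
Proof.
move=> ok; rewrite /mroots -map_comp map_id_in // => o.
rewrite mem_undup => /mem_pmap_split [s1 [b [s2 [E Eb]]]] /=.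
move: ok; rewrite E all_cat /= => /and3P [_ + _].
by case: b Eb {E} => //= [] [l|] m // [<-].
Qed.

Lemma mroots_uniq bl : all finite_block bl -> uniq (mroots bl).
Proof.
move=> ok; rewrite -(map_inj_uniq (@Some_inj _)) -eigs_finite //.
exact: undup_uniq.
Qed.

Lemma mroots_mem bl l : all finite_block bl -> (l \in mroots bl) = (Some l \in eigs bl).
Proof. by move=> ok; rewrite eigs_finite // mem_map //; apply: Some_inj. Qed.

Lemma mroots_block bl l : all finite_block bl -> l \in mroots bl ->
  exists s1 s2, bl = s1 ++ Jord (Some l) (mexp bl l) :: s2.
Proof.
move=> ok; rewrite mroots_mem // mem_undup => /mem_pmap_split [s1 [b [s2 [E Eb]]]].
have [m Em] : exists m, m \in jtuple bl (Some l).
  case: b E Eb => //= o m E [Eo]; exists m; rewrite mem_jtuple E.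
  by apply: pmap_split_mem; rewrite /= Eo eqxx.
have : mexp bl l \in jtuple bl (Some l).
  by rewrite /mexp; case: (jtuple _ _) Em => //= h t _; rewrite mem_head.
rewrite mem_jtuple => /mem_pmap_split [r1 [b' [r2 [E' /size_at_Some Eb']]]].
by exists r1, r2; rewrite -Eb'.
Qed.

Lemma mexp_gt0 bl l : all bvalid bl -> all finite_block bl -> l \in mroots bl ->
  (0 < mexp bl l)%N.
Proof.
move=> v ok /(mroots_block ok) [s1 [s2 E]].
by move: v; rewrite {1}E all_cat /= => /and3P [].
Qed.

Lemma minpol_dvd_block bl : all finite_block bl -> all (dvd_block (minpol bl)) bl.
Proof.
move=> ok; apply: all_splitP => s1 b s2 E; case: b E => //= [] [l|] // m E.
have Hl : l \in mroots bl.
  by rewrite mroots_mem // mem_undup E; apply: pmap_split_mem.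
rewrite /minpol; have [g -> _] := prod_XsubC_factor (mexp bl) (mroots_uniq ok) Hl.
apply: dvdp_mulr; apply: dvdp_exp2l; apply: jtuple_max.
by rewrite mem_jtuple E; apply: pmap_split_mem; rewrite /= eqxx.
Qed.

Lemma minpol_dvdp bl f : all finite_block bl -> all (dvd_block f) bl -> minpol bl %| f.
Proof.
move=> ok Hf; apply: dvdp_prod_XsubC; first exact: mroots_uniq.
move=> l /(mroots_block ok) [s1 [s2 E]].
by move: Hf; rewrite {1}E all_cat /= => /and3P [].
Qed.

Lemma size_mroots bl : size (mroots bl) = size (jtuples bl).
Proof. by rewrite !size_map. Qed.

(** The degree depends only on the Jordan tuples, hence is constant on generic pairs. *)
Lemma size_minpol bl : all finite_block bl ->
  size (minpol bl) = (sumn (map (head 0%N) (jtuples bl))).+1.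
Proof.
move=> ok; rewrite size_prod_XsubC_exp /jtuples eigs_finite //.
by congr _.+1; move: (mroots bl) => s; rewrite sumnE !big_map.
Qed.

Lemma count_gt1_split (T : Type) (p : pred T) s : (1 < count p s)%N ->
  exists s1 b s2 b' s3, [/\ s = s1 ++ b :: s2 ++ b' :: s3, p b & p b'].
Proof.
have one r : (0 < count p r)%N -> exists s1 b s2, r = s1 ++ b :: s2 /\ p b.
  elim: r => //= b r IH; case E: (p b) => /=; first by exists [::], b, r.
  by move/IH => [s1 [b' [s2 [-> H]]]]; exists (b :: s1), b', s2.
elim: s => //= b s IH; case E: (p b) => /=.
  rewrite add1n ltnS => /one [s1 [b' [s2 [-> H]]]].
  by exists [::], b, s1, b', s2.
move/IH => [s1 [b1 [s2 [b2 [s3 [-> H1 H2]]]]]].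
by exists (b :: s1), b1, s2, b2, s3.
Qed.

Lemma multmax_eigenvalues bl : all finite_block bl -> (1 < count multmax (jtuples bl))%N ->
  exists l1 l2, [/\ l1 != l2, l1 \in mroots bl, l2 \in mroots bl,
     multmax (jtuple bl (Some l1)) & multmax (jtuple bl (Some l2))].
Proof.
move=> ok; rewrite /jtuples eigs_finite // -map_comp count_map.
move/count_gt1_split => [s1 [l1 [s2 [l2 [s3 [E H1 H2]]]]]].
exists l1, l2; split=> //.
- have := mroots_uniq ok; rewrite E cat_uniq /= mem_cat inE !negb_or.
  by case/and3P=> _ _ /andP [/and3P []].
- by rewrite E mem_cat mem_head orbT.
- by rewrite E mem_cat inE mem_cat mem_head !orbT.
Qed.

Lemma multmax_blocks bl l : multmax (jtuple bl (Some l)) ->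
  exists s1 s2 s3, bl = s1 ++ Jord (Some l) (mexp bl l)
    :: s2 ++ Jord (Some l) (mexp bl l) :: s3.
Proof.
move=> mm; have : (1 < count_mem (mexp bl l) (jtuple bl (Some l)))%N.
  move: mm; rewrite /mexp /multmax; case: (jtuple _ _) => [|h [|h' t]] //= /eqP <-.
  by rewrite !eqxx.
have cE s : count_mem (mexp bl l) (pmap (size_at (Some l)) s) =
    count (fun b => size_at (Some l) b == Some (mexp bl l)) s.
  by elim: s => //= b s IH; case: (size_at _ b) => [m|] //=; rewrite IH.
rewrite jtupleE (permP (permEl (perm_sort _ _))) cE.
move/count_gt1_split => [s1 [b [s2 [b' [s3 [E /eqP H1 /eqP H2]]]]]].
by exists s1, s2, s3; rewrite -{1}(size_at_Some H1) -(size_at_Some H2).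
Qed.

(** * First variation of the minimal polynomial *)

Local Notation lift := (map_mx (polyC : C -> {poly C})).

Lemma sum_coefX (D : nat) (p : {poly C}) : (size p <= D)%N ->
  \sum_(k < D) p`_k *: 'X^k = p.
Proof.
move=> Hp; rewrite -poly_def; apply/polyP=> k; rewrite coef_poly.
by case: ltnP => // Hk; rewrite nth_default // (leq_trans Hp).
Qed.

Lemma size_sumX D (w : 'I_D -> C) : (size (\sum_k w k *: 'X^k)%R <= D)%N.
Proof.
apply: leq_trans (size_sum _ _ _) _; apply/bigmax_leqP => k _.
by apply: leq_trans (size_scale_leq _ _) _; rewrite size_polyXn.
Qed.

Definition ev (e : C) : {poly {poly C}} -> {poly C} := map_poly (horner_eval e).
HB.instance Definition _ e := GRing.RMorphism.copy (ev e) (map_poly (horner_eval e)).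

Lemma coef_ev e (P : {poly {poly C}}) k : (ev e P)`_k = (P`_k).[e].
Proof. by rewrite coef_map. Qed.

Lemma ev_sum e D (w : 'I_D -> {poly C}) :
  ev e (\sum_k w k *: 'X^k) = \sum_k (w k).[e] *: 'X^k.
Proof.
rewrite rmorph_sum; apply: eq_bigr => k _.
by rewrite /= /ev map_polyZ map_polyXn.
Qed.

Lemma ev0E (P : {poly {poly C}}) : ev 0 P = ev0 P.
Proof. by apply/polyP=> k; rewrite [LHS]coef_ev [RHS]coef_ev0 horner_coef0. Qed.

Section SpectralVariation.
Variables (n : nat) (A B S U : 'M[C]_n) (q : {poly C}) (D d : nat) (bl0 : seq jkblock).
Hypothesis BSA : B *m S *m A = A.
Hypothesis BSU : B *m S *m U = U.
Hypothesis q0 : q.[0] != 0.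
(** [D] is the degree of the minimal polynomial and [d] the number of distinct eigenvalues. *)
Definition stable_type bl :=
  [/\ all finite_block bl, size (minpol bl) = D.+1 & size (mroots bl) = d].
Hypothesis Hq : forall e, q.[e] != 0 ->
  exists2 bl, JKdecomp (A + e *: U) B bl & stable_type bl.
Hypothesis JK0 : JKdecomp A B bl0.
Hypothesis stable_type0 : stable_type bl0.

Let Ae := lift A + 'X *: lift U.
Let T k := lift B *m mxpow (lift S *m Ae) k.

Let T_horner e k i j : (T k i j).[e] = (B *m mxpow (S *m (A + e *: U)) k) i j.
Proof.
have -> : B *m mxpow (S *m (A + e *: U)) k = map_mx (horner_eval e) (T k).
  have eL (X : 'M[C]_n) : map_mx (horner_eval e) (lift X) = X.
    by apply/matrixP=> i' j'; rewrite !mxE /= /horner_eval hornerC.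
  rewrite map_mxM eL map_mxpow map_mxM eL map_mxD map_mxZ !eL /=.
  by rewrite /horner_eval hornerX.
by rewrite [RHS]mxE.
Qed.

Lemma relation_minpol e bl (f : nat -> C) :
  JKdecomp (A + e *: U) B bl -> stable_type bl ->
  (\sum_(k < D.+1) f k *: (B *m mxpow (S *m (A + e *: U)) k) == 0) =
  (minpol bl %| \sum_(k < D.+1) f k *: 'X^k).
Proof.
move=> [_ bln [P Pu [EA EB]]] [fin _ _].
have BSe : B *m S *m (A + e *: U) = A + e *: U.
  by rewrite mulmxDr -scalemxAr BSA BSU.
rewrite (relation_dvd bln fin Pu EA EB BSe); apply/idP/idP; first exact: minpol_dvdp.
move=> Hf; apply: sub_all (minpol_dvd_block fin) => b.
by case: b => //= [] [l|] // m /dvdp_trans; apply.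
Qed.

Lemma minpol_neq0 bl : minpol bl != 0.
Proof. by rewrite -size_poly_gt0 /minpol size_prod_XsubC_exp. Qed.

(** Off the zeros of [q] the minimal polynomial is a relation between the [D + 1] matrices [T k]. It
    lifts to coefficients polynomial in [e] and nontrivial at 0, where the relation is a multiple of
    [minpol bl0] of no larger degree; the constant [b / a] normalises it. *)
Lemma relation_family : exists2 w : 'I_D.+1 -> {poly C},
  \sum_k w k *: T k = 0 & \sum_k (w k).[0] *: 'X^k = minpol bl0.
Proof.
pose V (k : 'I_D.+1) (ij : 'I_n * 'I_n) := T k ij.1 ij.2.
have q_neq0 : q != 0 by apply: contraNneq q0 => ->; rewrite horner0.
have [|w [i wi] Hw] := dependency_specialization C_char0 (V := V) q_neq0.
  move=> e /Hq [bl JK Ht]; case: (Ht) => fin sz _.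
  exists (fun k : 'I_D.+1 => (minpol bl)`_k).
    exists ord_max; rewrite /= -[D]/(D.+1.-1) -sz -/(lead_coef _).
    by rewrite lead_coef_eq0 minpol_neq0.
  move=> ij; have := relation_minpol (fun k => (minpol bl)`_k) JK Ht.
  rewrite sum_coefX ?sz // dvdpp => /eqP /matrixP /(_ ij.1 ij.2) E.
  rewrite [RHS]mxE in E; rewrite -[RHS]E summxE; apply: eq_bigr => k _.
  by rewrite /V T_horner [RHS]mxE.
have rel : \sum_k w k *: T k = 0.
  apply/matrixP=> a b; rewrite summxE [RHS]mxE -[RHS](Hw (a, b)).
  by apply: eq_bigr => k _; rewrite mxE.
pose w0 (k : nat) := (w (inord k)).[0].
have : minpol bl0 %| \sum_(k < D.+1) (w k).[0] *: 'X^k.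
  have JK0' : JKdecomp (A + 0 *: U) B bl0 by rewrite scale0r addr0.
  have <- : \sum_(k < D.+1) w0 k *: 'X^k = \sum_(k < D.+1) (w k).[0] *: 'X^k.
    by apply: eq_bigr => k _; rewrite /w0 inord_val.
  rewrite -(relation_minpol w0 JK0' stable_type0); apply/eqP/matrixP=> a b.
  rewrite summxE [RHS]mxE.
  have /matrixP /(_ a b) /(congr1 (fun p => p.[0])) := rel.
  rewrite summxE mxE horner0 horner_sum => E; rewrite -[RHS]E.
  by apply: eq_bigr => k _; rewrite [LHS]mxE [X in _ = X.[_]]mxE hornerM T_horner /w0 inord_val.
set W := \sum_k _; have W0 : W != 0.
  apply/eqP=> /polyP /(_ i); rewrite /W coef_sum coef0 (bigD1 i) //= big1 => [|j ji].
    by rewrite coefZ coefXn eqxx mulr1 addr0 => /eqP; rewrite (negPf wi).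
  by rewrite coefZ coefXn eq_sym (inj_eq val_inj) (negPf ji) mulr0.
have [_ sz _] := stable_type0.
have sW : (size W <= D.+1)%N by apply: size_sumX.
move=> dv; have : minpol bl0 %= W.
  by rewrite -dvdp_size_eqp // eqn_leq dvdp_leq // sz.
move/eqp_eq => EW; set a := lead_coef W in EW; set b := lead_coef _ in EW.
have a0 : a != 0 by rewrite lead_coef_eq0.
have b0 : b != 0 by rewrite lead_coef_eq0 minpol_neq0.
exists (fun k => (b / a)%:P * w k).
  under eq_bigr => k _ do rewrite -scalerA.
  by rewrite -scaler_sumr rel scaler0.
under eq_bigr => k _ do rewrite hornerM hornerC -scalerA.
rewrite -scaler_sumr -/W mulrC -scalerA -EW scalerA mulVf ?scale1r //.
Qed.

(** That [M] keeps only [d] distinct roots is expressed by [M' H = M K] with [H] of degree at most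
    [d] and [K] of degree below [d]. This is linear in [H] and [K], so it lifts to the whole family;
    its terms of order 0 and 1 in [e] bound the order of the first variation at [l]. *)
Lemma spectral_variation : exists m : nat -> {poly C},
  [/\ \sum_(k < D.+1) m k *: T k = 0, ev0 (specpoly D.+1 m) = minpol bl0
    & forall l, l \in mroots bl0 -> (0 < mexp bl0 l)%N ->
        ('X - l%:P) ^+ (mexp bl0 l).-1 %| ev1 (specpoly D.+1 m)].
Proof.
have [w rel w0E] := relation_family.
pose m k := w (inord k); exists m.
have relm : \sum_(k < D.+1) m k *: T k = 0.
  by rewrite -[RHS]rel; apply: eq_bigr => k _; rewrite /m inord_val.
set M := specpoly _ _.
have EM : M = \sum_(k < D.+1) w k *: 'X^k.
  by apply: eq_bigr => k _; rewrite /m inord_val.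
have M0E : ev0 M = minpol bl0 by rewrite -ev0E EM ev_sum.
have [fin0 sz0 sr0] := stable_type0.
split=> // l Hl ml.
(* The unknowns are the coefficients of [H] and [K]; the equations are the coefficients of
   [M' H - M K], which vanish from index [size M + d.+1] on. *)
pose V (i : 'I_d.+1 + 'I_d) (j : 'I_(size M + d.+1)) : {poly C} :=
  match i with inl i => (M^`() * 'X^i)`_j | inr i => - (M * 'X^i)`_j end.
have q_neq0 : q != 0 by apply: contraNneq q0 => ->; rewrite horner0.
have [|h [i0 hi0] Hh] := dependency_specialization C_char0 (V := V) q_neq0.
  move=> e /Hq [bl JK Ht]; case: (Ht) => fin sz sr.
  have : minpol bl %| ev e M.
    have -> : ev e M = \sum_(k < D.+1) (m k).[e] *: 'X^k.
      by rewrite EM ev_sum; apply: eq_bigr => k _; rewrite /m inord_val.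
    rewrite -(relation_minpol (fun k => (m k).[e]) JK Ht); apply/eqP/matrixP=> a b.
    rewrite summxE [RHS]mxE.
    have /matrixP /(_ a b) /(congr1 (fun p => p.[e])) := relm.
    rewrite summxE mxE horner0 horner_sum => E; rewrite -[RHS]E.
    by apply: eq_bigr => k _; rewrite [LHS]mxE [X in _ = X.[_]]mxE hornerM T_horner.
  case/dvdpP=> r Er.
  have [K sK EK] := deriv_prod_XsubC (mroots bl) (mexp bl).
  set H := \prod_(i <- mroots bl) ('X - i%:P) in EK.
  have sH : size H = d.+1 by rewrite (size_prod_XsubC _ id) sr.
  have sM : (size (ev e M) <= size (minpol bl))%N by rewrite sz EM ev_sum size_sumX.
  (* The degree of [M] in the spectral parameter is at most [D], which leaves a constant
     cofactor. *)
  have [c Ec] : exists c, r = c%:P.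
    exists r`_0; apply: size1_polyC; have [-> | r0] := eqVneq r 0; first by rewrite size_poly0.
    move: sM; rewrite Er size_mul ?minpol_neq0 // sz addnS -[D.+1]add1n.
    by rewrite leq_add2r.
  have EHK : (ev e M)^`() * H = ev e M * K.
    by rewrite Er Ec derivM derivC mul0r add0r -mulrA EK mulrA.
  exists (fun i : ('I_d.+1 + 'I_d)%type => match i with inl i => H`_i | inr i => K`_i end).
    exists (inl ord_max); rewrite /= -[d]/(d.+1.-1) -sH -/(lead_coef _).
    by rewrite lead_coef_eq0 -size_poly_gt0 sH.
  move=> j; rewrite big_sumType /=.
  have -> : \sum_(i < d.+1) H`_i * ((M^`() * 'X^i)`_j).[e] = ((ev e M)^`() * H)`_j.
    rewrite -{2}(@sum_coefX d.+1 H) ?sH // mulr_sumr coef_sum; apply: eq_bigr => i _.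
    by rewrite -coef_ev rmorphM /= /ev map_polyXn -deriv_map -scalerAr coefZ.
  have -> : \sum_(i < d) K`_i * (- (M * 'X^i)`_j).[e] = - (ev e M * K)`_j.
    rewrite -{2}(@sum_coefX d K) -?sr // mulr_sumr coef_sum -sumrN; apply: eq_bigr => i _.
    by rewrite hornerN -coef_ev rmorphM /= /ev map_polyXn -scalerAr coefZ mulrN.
  by rewrite EHK subrr.
pose H := \sum_(i < d.+1) h (inl i) *: 'X^i.
pose K := \sum_(i < d) h (inr i) *: 'X^i.
have EHK : M^`() * H = M * K.
  apply/eqP; rewrite -subr_eq0; apply/eqP/polyP=> j; rewrite coef0 coefB.
  have -> : (M^`() * H)`_j = \sum_(i < d.+1) h (inl i) * (M^`() * 'X^i)`_j.
    by rewrite mulr_sumr coef_sum; apply: eq_bigr => i _; rewrite -scalerAr coefZ.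
  have -> : (M * K)`_j = \sum_(i < d) h (inr i) * (M * 'X^i)`_j.
    by rewrite mulr_sumr coef_sum; apply: eq_bigr => i _; rewrite -scalerAr coefZ.
  have [lt_j | le_j] := ltnP j (size M + d.+1).
    have := Hh (Ordinal lt_j); rewrite big_sumType /= => E; rewrite -[RHS]E.
    by congr (_ + _); rewrite -sumrN; apply: eq_bigr => i _; rewrite mulrN.
  rewrite !big1 ?subr0 // => i _.
    rewrite nth_default ?mulr0 // (leq_trans (size_polyMleq _ _)) // size_polyXn addnS /=.
    apply: leq_trans le_j; rewrite leq_add2l ltnW // ltnS ltnW //.
  rewrite nth_default ?mulr0 // (leq_trans (size_polyMleq _ _)) // size_polyXn addnS /=.
  apply: leq_trans le_j; rewrite leq_add //; last by rewrite ltnW.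
  by have [-> | /lt_size_deriv /ltnW //] := eqVneq M 0; rewrite deriv0.
have E0 : ev0 M * ev0 K = (ev0 M)^`() * ev0 H.
  by rewrite -ev0_deriv -!rmorphM EHK.
have E1 : ev1 M * ev0 K + ev0 M * ev1 K = (ev1 M)^`() * ev0 H + (ev0 M)^`() * ev1 H.
  by rewrite -ev0_deriv -ev1_deriv -!ev1M EHK.
have H0E : ev0 H = \sum_(i < d.+1) (h (inl i)).[0] *: 'X^i by rewrite -ev0E ev_sum.
have K0E : ev0 K = \sum_(i < d) (h (inr i)).[0] *: 'X^i by rewrite -ev0E ev_sum.
have cE N (u : 'I_N -> C) (i : 'I_N) : (\sum_k u k *: 'X^k)`_i = u i.
  rewrite coef_sum (bigD1 i) //= big1 => [|j ji].
    by rewrite coefZ coefXn eqxx mulr1 addr0.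
  by rewrite coefZ coefXn eq_sym (inj_eq val_inj) (negPf ji) mulr0.
(* If [H] vanished at [e = 0] then so would [K], against the nontriviality of the lifted dependency
   there. *)
have H0 : ev0 H != 0.
  apply/eqP=> H0; have K0 : ev0 K = 0.
    apply/eqP; move/eqP: E0; rewrite H0 mulr0 mulf_eq0 M0E (negPf (minpol_neq0 _)).
    by [].
  move: hi0; case: i0 => i.
    by rewrite -(cE _ (fun i => (h (inl i)).[0])) -H0E H0 coef0 eqxx.
  by rewrite -(cE _ (fun i => (h (inr i)).[0])) -K0E K0 coef0 eqxx.
have mp i : i \in mroots bl0 -> (0 < mexp bl0 i)%N by apply: mexp_gt0; case: JK0.
have [h0 EH h0l] : exists2 h0, ev0 H = ('X - l%:P) * h0 & h0.[l] != 0.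
  apply: (simple_root_log_derivative C_char0 (mroots_uniq fin0) mp (oner_neq0 _) _ H0 _ E0) => //.
    by rewrite scale1r M0E.
  by rewrite sr0 H0E size_sumX.
have [g Eg gl] := prod_XsubC_factor (mexp bl0) (mroots_uniq fin0) Hl.
apply: (dvdp_first_variation C_char0 _ gl EH h0l E0 E1).
by rewrite prednK // M0E.
Qed.

End SpectralVariation.

(** * Generic points *)

(** [q] is the restriction to the line of a defining polynomial that does not vanish at [v]. *)
Lemma zariski_line N (U : ('I_N -> C) -> Prop) (v d : 'I_N -> C) :
  zariski_open U -> U v ->
  exists2 q : {poly C}, q.[0] != 0 &
    forall e w, q.[e] != 0 -> (forall i, w i = v i + e * d i) -> U w.
Proof.
case=> T HT /HT [p Tp pv].
pose q : {poly C} := \sum_(m <- mpoly.msupp p)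
  (mpoly.mcoeff m p)%:P * \prod_i ((v i)%:P + d i *: 'X) ^+ (mpoly.fun_of_multinom m i).
have qE e w : (forall i, w i = v i + e * d i) -> q.[e] = mpoly.meval w p.
  move=> Hw; rewrite mpoly.mevalE /q horner_sum; apply: eq_bigr => m _.
  rewrite hornerM hornerC horner_prod; congr (_ * _); apply: eq_bigr => i _.
  by rewrite horner_exp hornerD hornerC hornerZ hornerX Hw mulrC.
exists q => [|e w qe Hw]; first by rewrite (qE 0 v) // => i; rewrite mul0r addr0.
by apply/HT; exists p => //; rewrite -(qE e).
Qed.

Definition point n (x a : 'rV[C]_n) : 'I_(n + n) -> C :=
  fun i => match split i with inl j => x 0 j | inr j => a 0 j end.

Lemma formA_fstpt n c (x a : 'rV[C]_n) : formA c (fstpt (point x a)) = formR c x.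
Proof.
apply/matrixP=> i j; rewrite !mxE; apply: eq_bigr => k _.
by rewrite /fstpt /point (unsplitK (inl k)).
Qed.

Lemma formA_sndpt n c (x a : 'rV[C]_n) : formA c (sndpt (point x a)) = formR c a.
Proof.
apply/matrixP=> i j; rewrite !mxE; apply: eq_bigr => k _.
by rewrite /sndpt /point (unsplitK (inr k)).
Qed.

Lemma regular_poly bl : exists2 r : {poly C}, r != 0 &
  forall e, r.[e] != 0 -> e != 0 /\ all (regular_at e) bl.
Proof.
elim: bl => [|b bl [r r0 Hr]].
  by exists 'X; rewrite ?polyX_eq0 // => e; rewrite hornerX.
pose rb : {poly C} := if b is Jord (Some l) _ then 1 + l *: 'X else 1.
exists (rb * r) => [|e].
  rewrite mulf_neq0 //; case: b @rb => [k|[l|] m] /=; rewrite ?oner_neq0 //.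
  apply/eqP=> /(congr1 (fun p => p.[0])).
  by rewrite !hornerE ?mulr0 ?addr0 => /eqP; rewrite oner_eq0.
rewrite hornerM mulf_eq0 negb_or => /andP [rbe /Hr [e0 reg]]; split=> //=.
rewrite reg andbT; case: b @rb rbe => [k|[l|] m] //=.
by rewrite !hornerE mulrC.
Qed.

Lemma formR_addZ n (c : 'I_n -> 'I_n -> 'I_n -> C) (x u : 'rV[C]_n) e :
  formR c (x + e *: u) = formR c x + e *: formR c u.
Proof.
apply/matrixP=> i j; rewrite !mxE mulr_sumr -big_split.
by apply: eq_bigr => k _; rewrite !mxE mulrDl mulrA.
Qed.

(** * Generic pairs of the Lie algebra and the contradiction *)

Section Main.
Variables (n : nat) (c : 'I_n -> 'I_n -> 'I_n -> C) (js : seq (seq nat)).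
Variable U : ('I_(n + n) -> C) -> Prop.
Hypothesis Hc : jacobi c.
Hypothesis Uopen : zariski_open U.
Hypothesis HU : forall v, U v -> exists bl,
  [/\ JKdecomp (formA c (fstpt v)) (formA c (sndpt v)) bl,
      perm_eq (kron_sizes bl) [:: 1%N] & perm_eq (jtuples bl) js].

Let D := sumn (map (head 0%N) js).
Let d := size js.

Lemma point_JK x a : U (point x a) -> exists bl,
  [/\ JKdecomp (formR c x) (formR c a) bl, kron_sizes bl = [:: 1%N]
    & perm_eq (jtuples bl) js].
Proof.
case/HU=> bl; rewrite formA_fstpt formA_sndpt => -[JK ks jt]; exists bl; split=> //.
by apply: perm_small_eq ks.
Qed.

Lemma point_line x a dx da : U (point x a) ->
  exists2 q : {poly C}, q.[0] != 0 &
    forall e, q.[e] != 0 -> U (point (x + e *: dx) (a + e *: da)).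
Proof.
move=> /(zariski_line (point dx da) Uopen) [q q0 Hq]; exists q => // e /Hq; apply=> i.
by rewrite /point; case: (split i) => j; rewrite !mxE.
Qed.

(** The given pair may have infinite eigenvalues. Replacing [a] by [a + e x] for a suitable [e]
    stays in [U] and makes the second form degenerate only along the Kronecker block. *)
Lemma generic_base (v : 'I_(n + n) -> C) : U v ->
  exists x a, U (point x a) /\ corank_le1 (formR c a).
Proof.
move=> Uv; pose x := \row_i fstpt v i; pose a := \row_i sndpt v i.
have Uxa : U (point x a).
  (* A line with zero direction carries membership in [U] over to a pointwise equal function. *)
  have [q q0 Hq] := zariski_line (fun=> 0) Uopen Uv.
  apply: (Hq 0) => // i; rewrite mulr0 addr0 /point -[in RHS](splitK i).
  by case: (split i) => j; rewrite mxE.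
have [bl [JK ks _]] := point_JK Uxa.
have [q q0 Hq] := point_line 0 x Uxa.
have [r r0 Hr] := regular_poly bl.
have q_neq0 : q != 0 by apply: contraNneq q0 => ->; rewrite horner0.
have [e] := nonroot_exists C_char0 (mulf_neq0 q_neq0 r0).
rewrite hornerM mulf_eq0 negb_or => /andP [/Hq + /Hr [e0 reg]].
rewrite scaler0 addr0 => Ue; exists x, (a + e *: x); split=> //.
by rewrite formR_addZ; apply: pencil_corank JK ks e0 reg.
Qed.

Variables (x a : 'rV[C]_n).
Hypothesis Uxa : U (point x a).
Hypothesis Bcorank : corank_le1 (formR c a).
Local Notation A := (formR c x).
Local Notation B := (formR c a).

Lemma direction_line u : exists2 q : {poly C}, q.[0] != 0 &
  forall e, q.[e] != 0 -> U (point (x + e *: u) a).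
Proof.
have [q q0 Hq] := point_line u 0 Uxa; exists q => // e /Hq.
by rewrite scaler0 addr0.
Qed.

Lemma direction_nonzero u : exists2 e, e != 0 & U (point (x + e *: u) a).
Proof.
have [q q0 Hq] := direction_line u.
have q_neq0 : q != 0 by apply: contraNneq q0 => ->; rewrite horner0.
have [e] := nonroot_exists C_char0 (mulf_neq0 q_neq0 (negbT (polyX_eq0 _))).
by rewrite hornerM hornerX mulf_eq0 negb_or => /andP [/Hq Ue e0]; exists e.
Qed.

(* [is_lie_algebra] only gives [c i i k = 0]; antisymmetry of the bracket has to be
   read off the normal forms. *)
Lemma formR_skew u : (formR c u)^T = - formR c u.
Proof.
have [bl0 [/JKdecomp_skew [As Bs] _ _]] := point_JK Uxa.
have [e e0 /point_JK [bl [/JKdecomp_skew [+ _] _ _]]] := direction_nonzero u.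
rewrite formR_addZ linearD /= linearZ /= As opprD => /addrI.
by rewrite -scalerN => /(scalerI e0).
Qed.

(** For each generic [(y, a)] the Kronecker block gives a common kernel vector, which lies in the
    kernel of [B] and so is proportional to [z]. Comparing two generic points on a line of direction
    [u] shows that [z] kills the form of [u]. *)
Lemma central_kernel (w : 'rV[C]_n) u : w *m B = 0 -> w *m formR c u = 0.
Proof.
have [z Hz] := Bcorank; move=> /Hz [t ->].
suff z0 : z *m formR c u = 0 by rewrite -scalemxAl z0 scaler0.
have zA y : U (point y a) -> z *m formR c y = 0.
  move/point_JK => [bl [JK ks _]].
  have [w' [w'0 w'A /Hz [s Es]]] := common_kernel JK ks.
  have s0 : s != 0 by apply: contraNneq w'0 => s0; rewrite Es s0 scale0r.
  by apply: (scalerI s0); rewrite scaler0 scalemxAl -Es.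
have [e e0 /zA] := direction_nonzero u.
rewrite formR_addZ mulmxDr (zA x Uxa) add0r -scalemxAr => /eqP.
by rewrite scaler_eq0 (negPf e0) => /eqP.
Qed.

(** [pinvmx] inverts on rows; transposition moves this to columns, and the sign is that of the skew
    form [B]. *)
Definition pseudo_inverse : 'M[C]_n := - (pinvmx B)^T.
Local Notation Si := pseudo_inverse.

Lemma pseudo_inverseE u : B *m Si *m formR c u = formR c u.
Proof.
have sub : (formR c u <= B)%MS.
  (* By skewness the cokernel of [B] transposes into its kernel, which is central. *)
  rewrite submxE; apply/eqP/trmx_inj; rewrite trmx0 trmx_mul formR_skew mulmxN.
  apply/eqP; rewrite oppr_eq0; apply/eqP/row_matrixP=> i; rewrite row_mul row0.
  apply: central_kernel; rewrite -row_mul; apply/rowP=> j.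
  have := mulmx_coker B; move/(congr1 trmx); rewrite trmx_mul trmx0 formR_skew mulmxN.
  by move/eqP; rewrite oppr_eq0 => /eqP ->; rewrite row0.
rewrite /pseudo_inverse mulmxN mulNmx; have := mulmxKpV sub.
move: (pinvmx B) => p /(congr1 trmx).
by rewrite !trmx_mul !formR_skew !mulmxN !mulNmx opprK mulmxA => ->; rewrite opprK.
Qed.

Lemma point_stable_type y bl : U (point y a) -> JKdecomp (formR c y) B bl ->
  kron_sizes bl = [:: 1%N] -> perm_eq (jtuples bl) js -> stable_type D d bl.
Proof.
move=> Uy JK ks jt; have fin := corank_le1_finite JK ks Bcorank.
split=> //; last by rewrite size_mroots (perm_size jt).
by rewrite size_minpol // (perm_sumn (perm_map _ jt)).
Qed.

Variable bl : seq jkblock.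
Hypothesis JK : JKdecomp A B bl.
Hypothesis ks : kron_sizes bl = [:: 1%N].
Hypothesis jt : perm_eq (jtuples bl) js.

Let ty : stable_type D d bl := point_stable_type Uxa JK ks jt.

Let Q := resolvent 'X (lift (Si *m A)) D.+1 (fun k => ((minpol bl)`_k)%:P).

Lemma variation u : exists (M1 : {poly C}) (Q1 : 'M[{poly C}]_n),
  [/\ ('X *: lift B - lift A) *m Q = minpol bl *: lift B,
      - lift (formR c u) *m Q + ('X *: lift B - lift A) *m Q1 = M1 *: lift B
    & forall l, l \in mroots bl -> ('X - l%:P) ^+ (mexp bl l).-1 %| M1].
Proof.
have [q q0 Hq] := direction_line u.
have Hq' e : q.[e] != 0 -> exists2 bl, JKdecomp (A + e *: formR c u) B bl & stable_type D d bl.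
  move=> /Hq Ue; have [bl' [JK' ks' jt']] := point_JK Ue; exists bl'.
    by rewrite -formR_addZ.
  exact: point_stable_type Ue JK' ks' jt'.
have [m [rel m0 m1]] := spectral_variation (pseudo_inverseE x) (pseudo_inverseE u) q0
  Hq' JK ty.
have [E0 [Q1 E1]] := resolvent_first_variation (pseudo_inverseE x) (pseudo_inverseE u) rel.
(* At [e = 0] the coefficients are those of [minpol bl], so [Q] is the same for all directions
   [u]. *)
have EQ : resolvent 'X (lift (Si *m A)) D.+1 (fun k => ((m k)`_0)%:P) = Q.
  apply: eq_bigr => k _; congr (_%:P *: _); rewrite -m0 coef_ev0 /specpoly.
  rewrite coef_sum (bigD1 k) //= big1 => [|j jk].
    by rewrite coefZ coefXn eqxx mulr1 addr0.
  by rewrite coefZ coefXn eq_sym (inj_eq val_inj) (negPf jk) mulr0.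
rewrite EQ m0 in E0; rewrite EQ in E1.
exists (ev1 (specpoly D.+1 m)), Q1; split=> // l Hl; apply: m1 => //.
by case: JK ty => v _ _ [fin _ _]; apply: mexp_gt0.
Qed.

(** In the basis [P] the form [B Q(l)] is [NFT n h] with [h] the quotient of the minimal polynomial
    by ['X - l]. On a block of maximal size only the corner of [h(J)] survives, so two such blocks
    provide the two orthogonal planes. *)
Lemma multmax_functional l : l \in mroots bl -> multmax (jtuple bl (Some l)) ->
  exists m : 'cV[C]_n, [/\ B *m m = 0, (a *m m) 0 0 != 0
                         & ((x - l *: a) *m m) 0 0 = 0].
Proof.
move=> Hl mm; case: (JK) (ty) => v bln [P Pu [EA EB]] [fin sz _].
have ml := mexp_gt0 v fin Hl.
have [g Eg gl] := prod_XsubC_factor (mexp bl) (mroots_uniq fin) Hl.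
have EM : minpol bl = ('X - l%:P) ^+ (mexp bl l).-1.+1 * g by rewrite prednK.
pose h := ('X - l%:P) ^+ (mexp bl l).-1 * g.
have [_ [_ [QE _ _]]] := variation 0.
have var u : exists (M1 : {poly C}) (Q1 : 'M_n),
    - lift (formR c u) *m Q + ('X *: lift B - lift A) *m Q1 = M1 *: lift B
    /\ ('X - l%:P) ^+ (mexp bl l).-1 %| M1.
  by have [M1 [Q1 [_ E1 /(_ l Hl) dv]]] := variation u; exists M1, Q1.
have leadE i j : lead c a Q l (P *m delta_mx i 0) (P *m delta_mx j 0) = NFT n h bl i j.
  have -> : NFT n h bl = P^T *m (B *m resolvent l (Si *m A) D.+1 (nth 0 (minpol bl))) *m P.
    apply/esym/(congr_divdiff bln fin Pu EA EB (pseudo_inverseE x)).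
    by rewrite sum_coefX ?sz // EM exprS mulrA.
  have evl (r s : nat) (X : 'M[C]_(r, s)) : map_mx (horner_eval l) (lift X) = X.
    by apply/matrixP=> i' j'; rewrite !mxE /= /horner_eval hornerC.
  have evQ : map_mx (horner_eval l) Q = resolvent l (Si *m A) D.+1 (nth 0 (minpol bl)).
    rewrite /Q map_resolvent evl /= /horner_eval hornerX.
    by apply: eq_bigr => k _ /=; rewrite hornerC.
  have evY (y z : 'cV[C]_n) : map_mx (horner_eval l) ((lift y)^T *m (lift B *m Q) *m lift z)
      = y^T *m (B *m resolvent l (Si *m A) D.+1 (nth 0 (minpol bl))) *m z.
    by rewrite !map_mxM map_trmx !evl evQ.
  rewrite /lead; move: (evY (P *m delta_mx i 0) (P *m delta_mx j 0)) => /matrixP /(_ 0 0).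
  rewrite [LHS]mxE => Eij; apply: (etrans Eij); rewrite trmx_mul trmx_delta !mulmxA.
  by rewrite -colE [LHS]mxE -!mulmxA -rowE [LHS]mxE.
have [s1 [s2 [s3 E]]] := multmax_blocks mm.
set b := Jord _ _ in E.
have hb : bsize b = (mexp bl l + mexp bl l)%N by rewrite /= mul2n addnn.
have p0 : (0 < bsize b)%N by rewrite hb addn_gt0 ml.
have p1 : (mexp bl l + (mexp bl l).-1 < bsize b)%N by rewrite hb ltn_add2l prednK.
have E' : bl = (s1 ++ b :: s2) ++ b :: s3 by rewrite -catA.
have bl12 : (bsizes s1 + bsize b <= bsizes (s1 ++ b :: s2))%N.
  by rewrite bsizes_cat leq_add2l leq_addr.
(* The first and last basis vectors of each of the two blocks: row and column of the corner
   entry. *)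
pose e0 := P *m delta_mx (Ordinal (block_pos bln E p0)) 0 : 'cV[C]_n.
pose f0 := P *m delta_mx (Ordinal (block_pos bln E p1)) 0 : 'cV[C]_n.
pose e1 := P *m delta_mx (Ordinal (block_pos bln E' p0)) 0 : 'cV[C]_n.
pose f1 := P *m delta_mx (Ordinal (block_pos bln E' p1)) 0 : 'cV[C]_n.
have corner : entryT h b 0 (mexp bl l + (mexp bl l).-1) = g.[l].
  rewrite /= /skewblk ml leq_addr /= addKn /toeplitz /= subn0.
  exact: taylor_coef_exp.
have in1 p : (p < bsize b)%N -> (bsizes s1 + p < bsizes (s1 ++ b :: s2))%N.
  by move=> Hp; apply: leq_trans bl12; rewrite ltn_add2l.
have in2 p : (bsizes s1 + bsize b <= bsizes (s1 ++ b :: s2) + p)%N.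
  exact: leq_trans bl12 (leq_addr _ _).
apply: (@lead_functional C C_char0 n c Hc x a Q (minpol bl) (minpol_neq0 bl) QE l
  (mexp bl l).-1 g EM gl (formR_skew x) (formR_skew a) var e0 f0 e1 f1).
- by rewrite leadE mxE /= {1}E bdiag_at // corner.
- by rewrite leadE mxE /= {1}E' bdiag_at // corner.
- by rewrite leadE mxE /= {1}E' bdiag_off // in1.
- by rewrite leadE mxE /= {1}E bdiag_off // in2 orbT.
- by rewrite leadE mxE /= {1}E' bdiag_off // in1.
- by rewrite leadE mxE /= {1}E bdiag_off // in2 orbT.
Qed.

(** For either eigenvalue the vector [m] is a nonzero multiple of the same [z^T], so both
    eigenvalues equal the quotient of the pairings of [x] and of [a] with [z]. *)
Lemma multmax_unique : ~ (1 < count multmax (jtuples bl))%N.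
Proof.
case: (ty) => fin _ _; case/(multmax_eigenvalues fin) => l1 [l2 [neq12 H1 H2 M1 M2]].
have [m1 [B1 a1 x1]] := multmax_functional H1 M1.
have [m2 [B2 a2 x2]] := multmax_functional H2 M2.
have [z Hz] := Bcorank.
have prop m : B *m m = 0 -> (a *m m) 0 0 != 0 -> exists2 t, t != 0 & m = t *: z^T.
  move=> Bm am; have [|t Et] := Hz m^T.
    apply: trmx_inj; rewrite trmx_mul trmxK formR_skew mulNmx Bm oppr0 trmx0.
    by [].
  have Em : m = t *: z^T by rewrite -[LHS]trmxK Et linearZ.
  exists t => //; apply: contraNneq am => t0.
  by rewrite Em t0 scale0r mulmx0 mxE.
have [t1 t10 E1] := prop m1 B1 a1; have [t2 t20 E2] := prop m2 B2 a2.
have ev t l (y : 'cV[C]_n) : t != 0 -> y = t *: z^T -> ((x - l *: a) *m y) 0 0 = 0 ->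
    (x *m z^T) 0 0 = l * (a *m z^T) 0 0.
  move=> t0 ->; rewrite -scalemxAr mxE => /eqP; rewrite mulf_eq0 (negPf t0) /=.
  rewrite mulmxBl -scalemxAl mxE [X in _ + X]mxE [X in _ - X]mxE subr_eq0.
  by move/eqP.
have az : (a *m z^T) 0 0 != 0.
  apply: contraNneq a1 => az; by rewrite E1 -scalemxAr mxE az mulr0.
have := ev t1 l1 m1 t10 E1 x1; rewrite (ev t2 l2 m2 t20 E2 x2).
by move/(mulIf az)/esym/eqP; rewrite (negPf neq12).
Qed.

End Main.

Theorem theorem17 :
  forall (n : nat) (c : 'I_n -> 'I_n -> 'I_n -> C)
         (ks : seq nat) (js : seq (seq nat)),
    is_lie_algebra c -> JKinvariants c ks js ->
    ~ (ks = [:: 1%N] /\ (1 < count multmax js)%N).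
Proof.
move=> n c ks js [_ Hc] [U [Uopen [v Uv] HU]] [Eks Hjs]; rewrite {}Eks in HU.
have [x [a [Uxa cork]]] := generic_base Uopen HU Uv.
have [bl [JK ks1 jt]] := point_JK HU Uxa.
apply: (multmax_unique Hc Uopen HU Uxa cork JK ks1 jt).
by rewrite (permP jt).
Qed.
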